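(* Let $d \geq 2$, let $\Lambda = Mat_d^0(\mathbb{Z})$, and let $B \subset \Lambda$ be a set of positive upper Banach density. Suppose there exists an ergodic Furstenberg system $(X,\eta,\sigma,\tilde B)$ corresponding to $B$ whose spectral measure has no atoms at non-trivial characters of $\Lambda$ of finite order. Then for every $C \in \Lambda$ there exist $A \in B - B$ and $g \in SL_d(\mathbb{Z})$ with $C = g^{-1}Ag$.
   Context: $Mat_d^0(\mathbb{Z})$ is the additive group of $d\times d$ integer matrices with trace zero. A sequence $(F_n)$ of finite subsets of a countable abelian group $G$ is Følner if $|F_n\cap(F_n+g)|/|F_n|\to 1$ for all $g\in G$. The upper Banach density of $B\subset G$ is $d^*(B)=\sup_{(F_n)\text{ Følner}}\limsup_n |B\cap F_n|/|F_n|$. A $G$-measure-preserving system $(X,\eta,\sigma)$ consists of a compact metric space $X$, a Borel probability measure $\eta$, and a measurable action $\sigma$ of $G$ on $X$ preserving $\eta$; it is ergodic if every $G$-invariant measurable set has measure $0$ or $1$. An ergodic Furstenberg system corresponding to $B$ is such an ergodic system $(X,\eta,\sigma)$ together with a measurable set $\tilde B\subset X$ satisfying $d^*(B\cap(B+h))\ge \eta(\tilde B\cap\sigma(h)\tilde B)$ for all $h\in G$ and $\eta(\tilde B)=d^*(B)$. Its spectral measure is the finite non-negative Borel measure $\nu$ on the dual group $\hat G$ with $\langle 1_{\tilde B},\sigma(h)1_{\tilde B}\rangle=\int_{\hat G}\chi(h)\,d\nu(\chi)$ for all $h\in G$ (given by Bochner's theorem), where $\langle f,\sigma(h)f\rangle=\int_X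 f(x)\overline{f(\sigma(h)x)}\,d\eta$-type Koopman inner product on $L^2(X,\eta)$. *)

(* Defs.v *)
From HB Require Import structures.
From mathcomp Require Import all_boot all_order all_algebra.
From mathcomp Require Import finmap.
From mathcomp Require Import all_classical all_reals all_analysis.

Unset Printing Implicit Defensive.

Import Order.TTheory GRing.Theory Num.Theory.
Import numFieldNormedType.Exports.

Local Open Scope classical_set_scope.
Local Open Scope ring_scope.

(* The group Lambda = Mat_d^0(Z): integer d x d matrices of trace zero.       *)
(* Elements of Lambda are represented as matrices A : 'M[int]_d with          *)
(* \tr A = 0; subsets of Lambda as sets of matrices all of whose elements     *)
(* have trace zero.                                                           *)

Definition trace0 (d : nat) (A : 'M[int]_d) : Prop := \tr A = 0.
Arguments trace0 {d} A.

Definition ftrans (d : nat) (F : {fset 'M[int]_d}) (g : 'M[int]_d)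
  : {fset 'M[int]_d} := [fset (x + g)%R | x in F]%fset.

Definition Folner (R : realType) (d : nat) (F : nat -> {fset 'M[int]_d}) : Prop :=
  (forall n x, x \in F n -> trace0 x) /\
  (forall g : 'M[int]_d, trace0 g ->
     (fun n => ((#|` (F n `&` ftrans _ (F n) g)%fset |)%:R
                 / (#|` F n |)%:R : R)) @ \oo --> (1 : R)).

Definition dens_ratio (R : realType) (d : nat) (B : set 'M[int]_d)
  (F : nat -> {fset 'M[int]_d}) (n : nat) : \bar R :=
  ((#|` [fset x in F n | `[< B x >]]%fset |)%:R / (#|` F n |)%:R : R)%:E.

Definition ubd (R : realType) (d : nat) (B : set 'M[int]_d) : \bar R :=
  ereal_sup [set limn_esup (dens_ratio R d B F) | F in [set F | Folner R d F]].

Definition strans (d : nat) (B : set 'M[int]_d) (h : 'M[int]_d) : set 'M[int]_d :=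
  [set b + h | b in B].

Definition borel (R : realType) (T : pseudoPMetricType R) :=
  g_sigma_algebraType (@open T).

Definition mps (R : realType) (d : nat) (T : pseudoPMetricType R)
  (eta : probability (borel R T) R) (sigma : 'M[int]_d -> borel R T -> borel R T)
  : Prop :=
  [/\ hausdorff_space T, compact [set: T] &
   [/\ (forall x, sigma 0 x = x),
      (forall g h x, trace0 g -> trace0 h -> sigma (g + h) x = sigma g (sigma h x)),
      (forall g, trace0 g -> measurable_fun [set: borel R T] (sigma g)) &
      (forall g (A : set (borel R T)), trace0 g -> measurable A ->
          eta (sigma g @^-1` A) = eta A)]].

Definition ergodic (R : realType) (d : nat) (T : pseudoPMetricType R)
  (eta : probability (borel R T) R) (sigma : 'M[int]_d -> borel R T -> borel R T)
  : Prop :=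
  forall A : set (borel R T), measurable A ->
    (forall g, trace0 g -> sigma g @^-1` A = A) ->
    eta A = 0%E \/ eta A = 1%E.

Definition furstenberg (R : realType) (d : nat) (B : set 'M[int]_d)
  (T : pseudoPMetricType R)
  (eta : probability (borel R T) R) (sigma : 'M[int]_d -> borel R T -> borel R T)
  (Bt : set (borel R T)) : Prop :=
  [/\ measurable Bt,
      (forall h, trace0 h ->
         (eta (Bt `&` (sigma h @` Bt)) <= ubd R d (B `&` strans d B h))%E) &
      eta Bt = ubd R d B].

(* The dual group of Lambda.  A complex number is represented as a pair of    *)
(* reals (real part, imaginary part).  A character of Lambda is a group       *)
(* homomorphism Lambda -> unit circle; as a function on all integer matrices  *)
(* it is normalised to be 1 off Lambda, so characters are in bijection with   *)
(* the elements of the dual group.                                            *)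

Definition cmul (R : realType) (a b : R * R) : R * R :=
  (a.1 * b.1 - a.2 * b.2, a.1 * b.2 + a.2 * b.1).

Definition cpow (R : realType) (a : R * R) (n : nat) : R * R :=
  iter n (cmul R a) (1, 0).

Definition is_character (R : realType) (d : nat) (chi : 'M[int]_d -> R * R) : Prop :=
  [/\ (forall A, trace0 A -> (chi A).1 ^+ 2 + (chi A).2 ^+ 2 = 1),
      (forall A B, trace0 A -> trace0 B -> chi (A + B) = cmul R (chi A) (chi B)) &
      (forall A, ~ trace0 A -> chi A = (1, 0))].

Record character (R : realType) (d : nat) := Character {
  chval :> 'M[int]_d -> R * R;
  chvalP : is_character R d chval }.

Lemma trivial_is_character (R : realType) (d : nat) :
  is_character R d (fun _ : 'M[int]_d => ((1 : R), (0 : R))).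
Proof.
split => //.
- by move=> A _ /=; rewrite expr1n expr0n /= addr0.
- by move=> A B _ _; rewrite /cmul /= !mulr0 !mul0r subr0 addr0 mulr1.
Qed.

Definition trivial_character (R : realType) (d : nat) : character R d :=
  @Character R d _ (@trivial_is_character R d).

HB.instance Definition _ (R : realType) (d : nat) := gen_eqMixin (character R d).
HB.instance Definition _ (R : realType) (d : nat) := gen_choiceMixin (character R d).
HB.instance Definition _ (R : realType) (d : nat) :=
  isPointed.Build (character R d) (trivial_character R d).

(* Borel sigma-algebra of the (compact, metrizable) dual group: generated by  *)
(* the evaluation maps chi |-> chi(h), h in Lambda (real and imaginary parts) *)
Definition dual_gen (R : realType) (d : nat) : set (set (character R d)) :=
  [set E | exists h : 'M[int]_d, exists U : set R, measurable U /\
     (E = (fun chi : character R d => (chi h).1) @^-1` U \/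
      E = (fun chi : character R d => (chi h).2) @^-1` U)].

Definition dual (R : realType) (d : nat) := g_sigma_algebraType (dual_gen R d).

(* nu is the spectral measure of 1_Bt: <1_Bt, sigma(h) 1_Bt> = \int chi(h) dnu *)
Definition spectral_measure (R : realType) (d : nat) (T : pseudoPMetricType R)
  (eta : probability (borel R T) R) (sigma : 'M[int]_d -> borel R T -> borel R T)
  (Bt : set (borel R T)) (nu : {finite_measure set dual R d -> \bar R}) : Prop :=
  forall h : 'M[int]_d, trace0 h ->
    eta (Bt `&` (sigma h @^-1` Bt)) = (\int[nu]_chi ((@chval R d chi h).1)%:E)%E /\
    0%E = (\int[nu]_chi ((@chval R d chi h).2)%:E)%E.

Definition nontrivial_finite_order (R : realType) (d : nat) (chi : character R d)
  : Prop :=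
  (exists A, trace0 A /\ chi A <> (1, 0)) /\
  (exists n : nat, (0 < n)%N /\ forall A, trace0 A -> cpow R (chi A) n = (1, 0)).

Definition no_finite_order_atoms (R : realType) (d : nat)
  (nu : {finite_measure set dual R d -> \bar R}) : Prop :=
  forall chi : dual R d, nontrivial_finite_order R d chi ->
    nu [set chi' : dual R d | @chval R d chi' = @chval R d chi] = 0%E.

Definition good_furstenberg_system (R : realType) (d : nat) (B : set 'M[int]_d)
  : Prop :=
  exists (T : pseudoPMetricType R) (eta : probability (borel R T) R)
         (sigma : 'M[int]_d -> borel R T -> borel R T) (Bt : set (borel R T))
         (nu : {finite_measure set dual R d -> \bar R}),
    [/\ mps R d T eta sigma, ergodic R d T eta sigma, furstenberg R d B T eta sigma Bt,
        spectral_measure R d T eta sigma Bt nu & no_finite_order_atoms R d nu].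

(* Main.v *)
(** Suppose that the correlations [eta (Bt `&` sigma A @^-1` Bt)], which are the
    integrals [\int chi(A) dnu], vanish for every conjugate [A] of [C <> 0].
    Conjugating [A] by the transvection [1 + m E_ij] gives
    [A + m (E A - A E) - m^2 E A E], so that [chi] evaluated there is a quadratic
    phase in [m].  Averaging over the multiples [m! k] of [m!], first in [k] and
    then in [m], kills by Weyl's theorem every [chi] that is not a root of unity
    on both coefficients and keeps [chi(A)] for the others.  Iterating over
    finitely many pairs [(i, j)], the integral of [chi(C)] over those [chi] that
    are roots of unity on a prescribed finite list of images of [C] under words
    in [A |-> E A - A E] and [A |-> - E A E] still vanishes.  As [C] is not
    scalar, such words reach nonzero multiples of generators of the whole group,
    so for a suitable list only characters of finite order remain; the
    nontrivial ones are countably many non-atoms, whence [nu] has no mass at the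
    trivial character.  But that mass is at least [eta(Bt)^2]: average the
    correlations over the differences of large boxes and use that a variance is
    nonnegative. *)

Require Import Defs.
From HB Require Import structures.
From mathcomp Require Import all_boot all_order all_algebra.
From mathcomp Require Import finmap.
From mathcomp Require Import all_classical all_reals all_analysis.
From mathcomp Require Import measurable_realfun complex ring lra zify.

Import Order.TTheory GRing.Theory Num.Theory.
Import numFieldNormedType.Exports Normc.
Local Open Scope classical_set_scope.
Local Open Scope ring_scope.

(** * Van der Corput's inequality in R[i] *)

Section QuadraticAverages.
Variable R : realType.
Implicit Types (u : nat -> R[i]) (x y c z w : R[i]).

Lemma normc_ge0 x : 0 <= normc x.
Proof. by case: x => a b /=; exact: sqrtr_ge0. Qed.

Lemma normc_real (a : R) : normc a%:C%C = `|a|.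
Proof. by rewrite /= expr0n addr0 sqrtr_sqr. Qed.

Lemma normc_nat (n : nat) : normc (n%:R : R[i]) = n%:R.
Proof. by rewrite -[n%:R](rmorph_nat (real_complex R)) normc_real normr_nat. Qed.

Lemma normcX x n : normc (x ^+ n) = normc x ^+ n.
Proof.
elim: n => [|n ih]; first by rewrite !expr0 normc1.
by rewrite !exprS normcM ih.
Qed.

Lemma normc_conj x : normc (conjc x) = normc x.
Proof. by case: x => a b /=; rewrite sqrrN. Qed.

Lemma mulc_conj x : x * conjc x = (normc x ^+ 2)%:C%C.
Proof. by rewrite -sqr_normc -add_Re2_Im2; case: x => a b /=; rewrite sqr_sqrtr // addr_ge0 ?sqr_ge0. Qed.

Lemma Re_le_normc x : `|complex.Re x| <= normc x.
Proof. by rewrite -lecR; apply: le_trans (normc_ge_Re x) _; case: x. Qed.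

Lemma normcD x y : normc (x + y) <= normc x + normc y.
Proof. exact: le_normcD. Qed.

Lemma normc_opp x : normc (- x) = normc x.
Proof. by case: x => a b /=; rewrite !sqrrN. Qed.

Lemma normcB x y : normc (x - y) <= normc x + normc y.
Proof. by apply: (le_trans (normcD _ _)); rewrite normc_opp. Qed.

Lemma normc_sum (I : Type) (r : seq I) (P : pred I) (F : I -> R[i]) :
  normc (\sum_(i <- r | P i) F i) <= \sum_(i <- r | P i) normc (F i).
Proof.
elim/big_rec2: _ => [|i y z _ le_yz]; first by rewrite normc0.
by apply: (le_trans (normcD _ _)); rewrite lerD2l.
Qed.

(** Cauchy-Schwarz, read off from the nonnegativity of the sum of squared deviations from the
    mean. *)
Lemma sqr_sum_le (N : nat) (x : 'I_N -> R) :
  (\sum_k x k) ^+ 2 <= N%:R * \sum_k x k ^+ 2.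
Proof.
case: N x => [|N] x; first by rewrite big_ord0 expr0n mul0r.
have Npos : 0 < N.+1%:R :> R by rewrite ltr0Sn.
have N0 : N.+1%:R != 0 :> R by rewrite gt_eqF.
set s := \sum_k x k.
have : 0 <= \sum_k (x k - s / N.+1%:R) ^+ 2 by apply: sumr_ge0 => k _; exact: sqr_ge0.
have -> : \sum_k (x k - s / N.+1%:R) ^+ 2 =
    \sum_k x k ^+ 2 - s ^+ 2 / N.+1%:R.
  transitivity (\sum_k (x k ^+ 2 - (s / N.+1%:R *+ 2) * x k + (s / N.+1%:R) ^+ 2)).
    by apply: eq_bigr => k _; ring.
  rewrite big_split sumrB /= -mulr_sumr -/s sumr_const card_ord -mulr_natl.
  by field.
by rewrite subr_ge0 ler_pdivrMr // mulrC.
Qed.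

(** After cancellation the last [h] shifted terms and the first [h] terms remain; the identity
    behind this also covers [h > N]. *)
Lemma sum_shift_le u (h N : nat) : (forall n, normc (u n) <= 1) ->
  normc (\sum_(k < N) u (k + h)%N - \sum_(k < N) u k) <= h%:R *+ 2.
Proof.
move=> u1.
have -> : \sum_(k < N) u (k + h)%N - \sum_(k < N) u k =
    \sum_(k < h) u (N + k)%N - \sum_(k < h) u k.
  have e : \sum_(k < h) u k + \sum_(k < N) u (k + h)%N =
           \sum_(k < N) u k + \sum_(k < h) u (N + k)%N.
    have E (a b : nat) : \sum_(k < a) u k + \sum_(k < b) u (a + k)%N = \sum_(k < a + b) u k.
      by rewrite big_split_ord.
    rewrite (E N h) addnC -(E h N); congr (_ + _).
    by apply: eq_bigr => k _; rewrite addnC.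
  rewrite -[X in X - _](addKr (\sum_(k < h) u k)) e; ring.
have bnd (v : nat -> R[i]) : (forall n, normc (v n) <= 1) ->
    normc (\sum_(k < h) v k) <= h%:R.
  move=> v1; apply: (le_trans (normc_sum _ _ _ _)).
  apply: (@le_trans _ _ (\sum_(k < h) 1)); last by rewrite sumr_const card_ord.
  by apply: ler_sum => k _; exact: v1.
apply: (le_trans (normcB _ _)); rewrite mulr2n.
by apply: lerD; [apply: (bnd (fun k => u (N + k)%N)) | apply: bnd].
Qed.

(** Replace [H] copies of the sum by the sum of the window sums [v k], apply Cauchy-Schwarz over [k]
    and expand the squares into correlations: each of the [H] diagonal ones is at most [N], all
    others are at most [K]. *)
Lemma van_der_Corput u (H N : nat) (K : R) : 0 <= K ->
  (forall n, normc (u n) <= 1) ->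
  (forall h h' : 'I_H, h != h' ->
     normc (\sum_(k < N) u (k + h)%N * conjc (u (k + h')%N)) <= K) ->
  (H%:R * normc (\sum_(k < N) u k)) ^+ 2 <=
  2 * (N%:R * (H%:R * N%:R + H%:R ^+ 2 * K)) + 8 * H%:R ^+ 4.
Proof.
move=> K0 u1 uK.
pose v (k : nat) := \sum_(h < H) u (k + h)%N.
set S := \sum_(k < N) u k; set V := \sum_(k < N) v k.
have dS : normc (H%:R * S - V) <= 2 * H%:R ^+ 2.
  have -> : H%:R * S - V = - \sum_(h < H) (\sum_(k < N) u (k + h)%N - S).
    rewrite sumrB sumr_const card_ord /V exchange_big /= opprB mulr_natl.
    by [].
  rewrite normc_opp; apply: (le_trans (normc_sum _ _ _ _)).
  apply: (@le_trans _ _ (\sum_(h < H) (H%:R *+ 2))).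
    apply: ler_sum => h _; apply: le_trans (sum_shift_le u h N u1) _.
    by rewrite lerMn2r /= ler_nat ltnW.
  rewrite sumr_const card_ord le_eqVlt; apply/orP; left; apply/eqP.
  by rewrite -[LHS]mulr_natr -[_ *+ 2]mulr_natr; ring.
have V2 : normc V ^+ 2 <= N%:R * (H%:R * N%:R + H%:R ^+ 2 * K).
  apply: (@le_trans _ _ (N%:R * \sum_(k < N) normc (v k) ^+ 2)).
    apply: le_trans (sqr_sum_le N (fun k => normc (v k))).
    rewrite ler_sqr ?nnegrE ?normc_ge0 ?normc_sum //.
    by apply: sumr_ge0 => k _; exact: normc_ge0.
  apply: ler_wpM2l; first exact: ler0n.
  have -> : \sum_(k < N) normc (v k) ^+ 2 = normc (\sum_(k < N) v k * conjc (v k)).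
    have -> : \sum_(k < N) v k * conjc (v k) = (\sum_(k < N) normc (v k) ^+ 2)%:C%C.
      by rewrite rmorph_sum; apply: eq_bigr => k _; rewrite mulc_conj.
    by rewrite normc_real ger0_norm // sumr_ge0 // => k _; exact: sqr_ge0.
  have -> : \sum_(k < N) v k * conjc (v k) =
     \sum_(h < H) \sum_(h' < H) \sum_(k < N) u (k + h)%N * conjc (u (k + h')%N).
    under eq_bigr => k _ do rewrite /v rmorph_sum mulr_suml.
    rewrite exchange_big; apply: eq_bigr => h _ /=.
    under eq_bigr => k _ do rewrite mulr_sumr.
    by rewrite exchange_big.
  apply: (le_trans (normc_sum _ _ _ _)).
  apply: (@le_trans _ _ (\sum_(h < H) (N%:R + H%:R * K))); last first.
    by rewrite sumr_const card_ord -[_ *+ H]mulr_natl mulrDr expr2 mulrA.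
  apply: ler_sum => h _; apply: (le_trans (normc_sum _ _ _ _)).
  rewrite (bigD1 h) //=; apply: lerD.
    apply: (le_trans (normc_sum _ _ _ _)).
    apply: (@le_trans _ _ (\sum_(k < N) 1)); last by rewrite sumr_const card_ord.
    apply: ler_sum => k _; rewrite normcM normc_conj -expr2.
    by rewrite expr_le1 ?normc_ge0.
  apply: (@le_trans _ _ (\sum_(h' < H | h' != h) K)).
    by apply: ler_sum => h' h'h; apply: uK; rewrite eq_sym.
  rewrite sumr_const -[K *+ _]mulr_natl ler_wpM2r // ler_nat.
  by apply: leq_trans (max_card _) _; rewrite card_ord.
have : H%:R * normc S <= normc V + 2 * H%:R ^+ 2.
  rewrite -[H%:R in X in X <= _]normc_nat -normcM.
  rewrite -[_ * S](subrK V) [_ - V + V]addrC; apply: (le_trans (normcD _ _)).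
  by rewrite lerD2l.
move: V2 (normc_ge0 V) (normc_ge0 S); move: (normc V) (normc S) => a b a2 a0 b0 hb.
have h0 : 0 <= H%:R :> R by exact: ler0n.
(* The bound [(a + b) ^ 2 <= 2 a ^ 2 + 2 b ^ 2] with [b = 2 H ^ 2] produces the error [8 H ^ 4]. *)
apply: (@le_trans _ _ ((a + 2 * H%:R ^+ 2) ^+ 2)).
  by rewrite ler_sqr ?nnegrE ?mulr_ge0 ?addr_ge0 ?sqr_ge0 ?mulr_ge0 ?exprn_ge0.
have : 0 <= (a - 2 * H%:R ^+ 2) ^+ 2 by exact: sqr_ge0.
move: (N%:R * _) a2 => q a2 hh.
have e : (a + 2 * H%:R ^+ 2) ^+ 2 = 2 * a ^+ 2 + 8 * H%:R ^+ 4 - (a - 2 * H%:R ^+ 2) ^+ 2 by ring.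
rewrite e; lra.
Qed.
End QuadraticAverages.

(** * Averages of quadratic phases *)

Section QuadraticLimits.
Variable R : realType.
Implicit Types (u : nat -> R[i]) (x y p c z w : R[i]).

Definition root_of_unity z := exists q : nat, (0 < q)%N /\ z ^+ q = 1.

(** Factorial lengths are eventually multiples of any given period, so the means of a periodic
    sequence are eventually constant. *)
Definition fact_mean (f : nat -> R) (N : nat) : R :=
  (\sum_(k < N`!) f k) / (N`!)%:R.

Definition mean0 u := forall e : R, 0 < e ->
  exists N0, forall N, (N0 <= N)%N -> normc (\sum_(k < N) u k) <= e * N%:R.

Lemma mean0_of_bounded u (K : R) :
  (forall N, normc (\sum_(k < N) u k) <= K) -> mean0 u.
Proof.
move=> uK e e0; exists (Num.trunc (K / e)).+1 => N hN.
apply: (le_trans (uK N)); rewrite mulrC -ler_pdivrMr //.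
apply: ltW; apply: (lt_le_trans (truncnS_gt _)).
by rewrite ler_nat.
Qed.

(** Multiplying the sum by [z - 1] gives its shift by [Q] minus the sum itself. *)
Lemma sum_le_of_shift u (Q N : nat) z : (forall n, normc (u n) <= 1) ->
  (forall n, u (n + Q)%N = z * u n) -> z != 1 ->
  normc (\sum_(k < N) u k) <= Q%:R *+ 2 / normc (z - 1).
Proof.
move=> u1 uz z1.
have nz : 0 < normc (z - 1).
  rewrite lt_def normc_ge0 andbT; apply: contra_neq z1 => /eq0_normc/eqP.
  by rewrite subr_eq0 => /eqP.
rewrite ler_pdivlMr // -normcM.
have <- : \sum_(k < N) u (k + Q)%N - \sum_(k < N) u k = (\sum_(k < N) u k) * (z - 1).
  rewrite mulrBr mulr1 mulrC mulr_sumr; congr (_ - _).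
  by apply: eq_bigr => k _; rewrite uz.
exact: sum_shift_le.
Qed.

Lemma mean0_of_shift u (Q : nat) z : (forall n, normc (u n) <= 1) ->
  (forall n, u (n + Q)%N = z * u n) -> z != 1 -> mean0 u.
Proof. by move=> u1 uz z1; apply: mean0_of_bounded => N; exact: sum_le_of_shift. Qed.

Section QuadraticPhase.
Variables c z w : R[i].
Hypotheses (c1 : normc c = 1) (z1 : normc z = 1) (w1 : normc w = 1).

Let u (n : nat) := c * z ^+ n * w ^+ (n ^ 2).

Lemma normc_phase n : normc (u n) = 1.
Proof. by rewrite /u !normcM !normcX c1 z1 w1 !expr1n !mul1r. Qed.

Lemma phase_shift h k : u (k + h)%N = u k * (z ^+ h * w ^+ (h ^ 2)) * (w ^+ (2 * h)) ^+ k.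
Proof.
rewrite /u (_ : (k + h) ^ 2 = k ^ 2 + h ^ 2 + 2 * h * k)%N; last by ring.
rewrite -exprM !exprD; ring.
Qed.

Lemma normc1_conj x : normc x = 1 -> x * conjc x = 1.
Proof. by move=> x1; rewrite mulc_conj x1 expr1n. Qed.

(** Weyl's argument: [u (k + h)] times the conjugate of [u (k + h')] is a constant times a geometric
    sequence of ratio [w ^ (2 (h - h'))], which differs from 1 for [h != h']. Its sums are bounded,
    so van der Corput's inequality applies. *)
Lemma mean0_irrational : ~ root_of_unity w -> mean0 u.
Proof.
move=> wnt.
have c2 : normc (conjc w) = 1 by rewrite normc_conj.
(* The conjugate of [w] is its inverse; using it keeps the exponents natural. *)
pose rho (h h' : nat) := w ^+ (2 * h) * conjc w ^+ (2 * h').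
have rho1 h h' : normc (rho h h') = 1.
  by rewrite /rho normcM !normcX w1 c2 !expr1n mulr1.
have rho_neq1 h h' : h != h' -> rho h h' != 1.
  have key a b : (a < b)%N -> w ^+ (2 * a) != w ^+ (2 * b).
    move=> ab; apply: contra_notN wnt => /eqP e.
    exists (2 * (b - a))%N; split; first by lia.
    have w0 : w ^+ (2 * a) != 0.
      by rewrite expf_neq0 //; apply: contra_eq_neq w1 => ->; rewrite normc0 eq_sym oner_eq0.
    apply: (mulfI w0); rewrite -exprD mulr1 [RHS]e; congr (_ ^+ _); lia.
  have aux : rho h h' = 1 -> w ^+ (2 * h) = w ^+ (2 * h').
    move=> e; have := congr1 (fun x => x * w ^+ (2 * h')) e.
    rewrite /= mul1r => <-; rewrite /rho -mulrA -exprMn [conjc w * w]mulrC normc1_conj //.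
    by rewrite expr1n mulr1.
  by rewrite neq_ltn => /orP hh; apply/eqP => /aux e; case: hh => /key; rewrite e eqxx.
have pair (H N : nat) (h h' : 'I_H) : h != h' ->
    normc (\sum_(k < N) u (k + h)%N * conjc (u (k + h')%N)) <=
    2 / normc (rho h h' - 1).
  move=> hh.
  have -> : \sum_(k < N) u (k + h)%N * conjc (u (k + h')%N) =
     (z ^+ h * w ^+ (h ^ 2)) * conjc (z ^+ h' * w ^+ (h' ^ 2)) *
     \sum_(k < N) rho h h' ^+ k.
    rewrite mulr_sumr; apply: eq_bigr => k _; rewrite !phase_shift.
    move: (u k) (normc1_conj _ (normc_phase k)) => a ab.
    rewrite /rho exprMn !rmorphM /= !rmorphXn /=.
    set X := (X in _ = X); rewrite -[X]mul1r -ab /X; ring.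
  rewrite !normcM normc_conj normcM !normcX z1 w1 !expr1n !mul1r.
  apply: (sum_le_of_shift (fun k => rho h h' ^+ k) 1).
  - by move=> n; rewrite normcX rho1 expr1n.
  - by move=> n; rewrite addn1 exprS.
  - exact: rho_neq1.
move=> e e0.
(* This [H] makes the diagonal term [2 H N ^ 2] at most half of [(H e N) ^ 2]; a large [N] then fits
   the remaining terms into the other half. *)
pose H := (Num.trunc (4 / e ^+ 2)).+1.
have H0 : 0 < H%:R :> R by rewrite ltr0Sn.
have He : 4 < e ^+ 2 * H%:R.
  by rewrite mulrC -ltr_pdivrMr ?exprn_gt0 // truncnS_gt.
(* The sum over all pairs bounds each off-diagonal correlation; its diagonal terms are
   [2 / 0 = 0]. *)
pose K : R := \sum_(h < H) \sum_(h' < H) 2 / normc (rho h h' - 1).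
have K0 : 0 <= K.
  by apply: sumr_ge0 => h _; apply: sumr_ge0 => h' _; rewrite divr_ge0 ?normc_ge0.
have pK h h' N : h != h' ->
    normc (\sum_(k < N) u (k + (h : 'I_H))%N * conjc (u (k + (h' : 'I_H))%N)) <= K.
  move=> hh; apply: (le_trans (pair _ _ _ _ hh)).
  rewrite /K (bigD1 h) //= (bigD1 h') //= -addrA lerDl.
  apply: addr_ge0; first by apply: sumr_ge0 => k _; rewrite divr_ge0 ?normc_ge0.
  by apply: sumr_ge0 => i _; apply: sumr_ge0 => k _; rewrite divr_ge0 ?normc_ge0.
pose T := 2 * K + 8 * H%:R ^+ 2.
exists (Num.trunc (2 * T / e ^+ 2)).+1 => N hN.
have N0 : 0 < N%:R :> R by rewrite ltr0n; apply: leq_trans hN.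
have N1 : 1 <= N%:R :> R by rewrite ler1n; apply: leq_trans hN.
have Ne : 2 * T < e ^+ 2 * N%:R.
  rewrite [ltRHS]mulrC -ltr_pdivrMr ?exprn_gt0 //; apply: (lt_le_trans (truncnS_gt _)).
  by rewrite ler_nat.
have uN1 n : normc (u n) <= 1 by rewrite normc_phase.
have := van_der_Corput R u H N K K0 uN1 (fun h h' => pK h h' N).
set s := normc _.
have s0 : 0 <= s by exact: normc_ge0.
move=> vdC.
rewrite -(@ler_pXn2r _ 2) // ?nnegrE ?mulr_ge0 ?(ltW e0) ?(ltW N0) //.
rewrite -(@ler_pM2l _ (H%:R ^+ 2)) ?exprn_gt0 // -exprMn.
apply: (le_trans vdC).
have h1 : 4 * (H%:R * N%:R ^+ 2) <= e ^+ 2 * H%:R * (H%:R * N%:R ^+ 2).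
  by rewrite ler_wpM2r ?(ltW He) // mulr_ge0 ?exprn_ge0 ?(ltW H0) ?(ltW N0).
have h2 : 2 * T * (H%:R ^+ 2 * N%:R) <= e ^+ 2 * N%:R * (H%:R ^+ 2 * N%:R).
  by rewrite ler_wpM2r ?(ltW Ne) // mulr_ge0 ?exprn_ge0 ?(ltW H0) ?(ltW N0).
have h3 : 8 * H%:R ^+ 4 * 1 <= 8 * H%:R ^+ 4 * N%:R :> R.
  by apply: ler_wpM2l; rewrite ?mulr_ge0 ?exprn_ge0 ?(ltW H0).
rewrite /T in h2.
have e1 : e ^+ 2 * H%:R * (H%:R * N%:R ^+ 2) = H%:R ^+ 2 * (e * N%:R) ^+ 2 by ring.
have e2 : e ^+ 2 * N%:R * (H%:R ^+ 2 * N%:R) = H%:R ^+ 2 * (e * N%:R) ^+ 2 by ring.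
rewrite e1 in h1; rewrite e2 in h2.
move: h1 h2 h3; move: (H%:R ^+ 2 * (e * N%:R) ^+ 2) => X; nra.
Qed.

End QuadraticPhase.

Lemma fact_mean_cvg0 u : mean0 u ->
  fact_mean (fun k => complex.Re (u k)) @ \oo --> (0 : R).
Proof.
move=> u0; apply/cvgrPdist_le => e e0; have [N0 hN0] := u0 e e0.
near=> N; rewrite sub0r normrN /fact_mean.
have NF : 0 < (N`!)%:R :> R by rewrite ltr0n fact_gt0.
rewrite normrM [X in _ * X]gtr0_norm ?invr_gt0 // ler_pdivrMr //.
apply: (@le_trans _ _ (normc (\sum_(k < N`!) u k))).
  by rewrite -(raddf_sum (@complex.Re R : Rcomplex R -> R)) Re_le_normc.
apply: hN0; apply: leq_trans (fact_geq N); near: N; exact: nbhs_infty_ge.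
Unshelve. all: by end_near. Qed.

Lemma fact_mean_cvg_finsupp (f : nat -> R) (N0 : nat) :
  (forall k, (N0 <= k)%N -> f k = 0) -> fact_mean f @ \oo --> (0 : R).
Proof.
move=> f0; apply: (fact_mean_cvg0 (fun k => (f k)%:C%C)).
apply: (mean0_of_bounded _ (\sum_(k < N0) `|f k|)) => N.
apply: (le_trans (normc_sum _ _ _ _ _)).
under eq_bigr do rewrite normc_real.
have [h|h] := leqP N N0.
  by rewrite -(subnKC h) big_split_ord /= lerDl sumr_ge0.
rewrite -(subnKC (ltnW h)) big_split_ord /= gerDl.
by rewrite big1 // => k _; rewrite f0 ?normr0 // leq_addr.
Qed.

Lemma fact_mean_periodic (f : nat -> R) (Q : nat) : (0 < Q)%N ->
  (forall n, f (n + Q)%N = f n) ->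
  fact_mean f @ \oo --> ((\sum_(k < Q) f k) / Q%:R : R).
Proof.
move=> Q0 fQ.
have fm j n : f (n + j * Q)%N = f n.
  by elim: j => [|j ih]; rewrite ?addn0 // mulSn addnCA addnC fQ ih.
have sumQ j : \sum_(k < j * Q) f k = j%:R * \sum_(k < Q) f k.
  elim: j => [|j ih]; first by rewrite mul0n big_ord0 mul0r.
  rewrite mulSn addnC big_split_ord /= ih -natr1 mulrDl mul1r; congr (_ + _).
  by apply: eq_bigr => k _; rewrite addnC fm.
apply: cvg_near_cst; near=> N.
have /dvdnP [j Ej] : (Q %| N`!)%N.
  by apply: dvdn_fact; rewrite Q0; near: N; exact: nbhs_infty_ge.
have j0 : (0 < j)%N by move: (fact_gt0 N); rewrite Ej muln_gt0 => /andP[].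
rewrite /fact_mean Ej sumQ natrM; field.
by rewrite !pnatr_eq0 -!lt0n j0 Q0.
Unshelve. all: by end_near. Qed.

(** * Roots of unity as a pure subgroup *)

Lemma root_of_unityM z w :
  root_of_unity z -> root_of_unity w -> root_of_unity (z * w).
Proof.
move=> [q [q0 zq]] [p [p0 wp]]; exists (q * p)%N; split; first by rewrite muln_gt0 q0.
by rewrite exprMn exprM zq expr1n mulnC exprM wp expr1n mul1r.
Qed.

Lemma root_of_unityV z : root_of_unity z -> root_of_unity z^-1.
Proof. by move=> [q [q0 zq]]; exists q; rewrite exprVn zq invr1. Qed.

Lemma root_of_unityX z n : root_of_unity z -> root_of_unity (z ^+ n).
Proof.
by move=> [q [q0 zq]]; exists q; rewrite exprAC zq expr1n.
Qed.

Lemma root_of_unity_rootX z n : (0 < n)%N -> root_of_unity (z ^+ n) -> root_of_unity z.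
Proof.
by move=> n0 [q [q0 zq]]; exists (n * q)%N; rewrite exprM muln_gt0 n0.
Qed.

Lemma normc_neq0 z : normc z = 1 -> z != 0.
Proof. by move=> z1; apply: contra_eq_neq z1 => ->; rewrite normc0 eq_sym oner_eq0. Qed.

(* Roots of unity are a pure subgroup, so a quadratic phase that meets it three
   times has all its coefficients there (Lagrange interpolation). *)
Lemma phase_root_of_unity p z w (a b c : nat) :
  p != 0 -> z != 0 -> w != 0 -> (a < b < c)%N ->
  (forall n, n \in [:: a; b; c] -> root_of_unity (p * z ^+ n * w ^+ (n ^ 2))) ->
  [/\ root_of_unity p, root_of_unity z & root_of_unity w].
Proof.
move=> p0 z0 w0 /andP[ab bc] H.
(* The quotient of the values at [m] and [n] is the [(m - n)]-th power of the divided difference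
   [z * w ^ (n + m)]; two such differences then isolate [w]. *)
have slope n m : (n < m)%N -> root_of_unity (p * z ^+ n * w ^+ (n ^ 2)) ->
    root_of_unity (p * z ^+ m * w ^+ (m ^ 2)) -> root_of_unity (z * w ^+ (n + m)).
  move=> nm Hn Hm; apply: (root_of_unity_rootX _ (m - n)); first by rewrite subn_gt0.
  suff -> : (z * w ^+ (n + m)) ^+ (m - n) =
      p * z ^+ m * w ^+ (m ^ 2) * (p * z ^+ n * w ^+ (n ^ 2))^-1.
    by apply: root_of_unityM => //; exact: root_of_unityV.
  have [e ->] : exists e, m = (n + e)%N by exists (m - n)%N; rewrite subnKC // ltnW.
  rewrite addKn exprMn -exprM (_ : ((n + e) ^ 2 = n ^ 2 + (n + (n + e)) * e)%N); last by ring.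
  rewrite [w ^+ (n ^ 2 + _)]exprD [z ^+ (n + e)]exprD.
  move: (w ^+ ((n + (n + e)) * e)) (expf_neq0 n z0) (expf_neq0 (n ^ 2) w0) => x.
  by move: (z ^+ n) (z ^+ e) (w ^+ (n ^ 2)) => y t s y0 s0; field; rewrite p0 y0 s0.
have Ha := H a; have Hb := H b; have Hc := H c.
move: Ha Hb Hc; rewrite !inE !eqxx ?orbT => /(_ isT) Ha /(_ isT) Hb /(_ isT) Hc.
have sab := slope _ _ ab Ha Hb; have sac := slope _ _ (ltn_trans ab bc) Ha Hc.
have rw : root_of_unity w.
  apply: (root_of_unity_rootX _ (c - b)); first by rewrite subn_gt0.
  have -> : w ^+ (c - b) = z * w ^+ (a + c) * (z * w ^+ (a + b))^-1.
    have [e ->] : exists e, c = (b + e)%N by exists (c - b)%N; rewrite subnKC // ltnW.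
    rewrite addKn addnA [w ^+ (_ + e)]exprD; move: (expf_neq0 (a + b) w0).
    by move: (w ^+ (a + b)) (w ^+ e) => x y x0; field; rewrite z0 x0.
  by apply: root_of_unityM => //; exact: root_of_unityV.
have rz : root_of_unity z.
  have -> : z = z * w ^+ (a + b) * (w ^+ (a + b))^-1 by field; rewrite expf_neq0.
  by apply: root_of_unityM => //; apply/root_of_unityV/root_of_unityX.
split=> //.
have -> : p = p * z ^+ a * w ^+ (a ^ 2) * (z ^+ a * w ^+ (a ^ 2))^-1.
  by field; rewrite !expf_neq0.
apply: root_of_unityM => //; apply: root_of_unityV.
by apply: root_of_unityM; exact: root_of_unityX.
Qed.

(** Otherwise the phase would be a root of unity for arbitrarily large [k], hence at three distinct
    arguments. *)
Lemma phase_eventually_irrational p z w (M : nat) : (0 < M)%N ->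
  p != 0 -> z != 0 -> w != 0 ->
  ~ [/\ root_of_unity p, root_of_unity z & root_of_unity w] ->
  exists N0, forall k, (N0 <= k)%N ->
    ~ root_of_unity (p * z ^+ (M * k) * w ^+ ((M * k) ^ 2)).
Proof.
move=> M0 p0 z0 w0 H; apply: contrapT => hN; apply: H.
have next N : exists k, (N <= k)%N /\ root_of_unity (p * z ^+ (M * k) * w ^+ ((M * k) ^ 2)).
  apply: contrapT => hk; apply: hN; exists N => k Nk hr; apply: hk; by exists k.
have [a [_ Ha]] := next 0%N; have [b [ab Hb]] := next a.+1; have [c [bc Hc]] := next b.+1.
apply: (phase_root_of_unity p z w (M * a) (M * b) (M * c)) => //.
  by rewrite !ltn_pmul2l // ab bc.
by move=> n; rewrite !inE => /or3P[] /eqP->.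
Qed.

(** If [w] is not a root of unity, Weyl's argument gives 0. If [w ^ q = 1], a shift by [q]
    multiplies the phase by [z ^ q]: either [z ^ q != 1] and the mean is 0, or the phase has period
    [q]. The limit, in general a Gauss sum, is evaluated only in the extreme cases. *)
Lemma phase_mean_ex c z w : normc c = 1 -> normc z = 1 -> normc w = 1 ->
  exists L : R,
  [/\ fact_mean (fun k => complex.Re (c * z ^+ k * w ^+ (k ^ 2))) @ \oo --> L,
     (~ (root_of_unity z /\ root_of_unity w) -> L = 0) &
     (z = 1 -> w = 1 -> L = complex.Re c)].
Proof.
move=> c1 z1 w1.
have [[q [q0 wq]]|wn] := pselect (root_of_unity w); last first.
  exists 0; split => // [|_ e]; first exact/fact_mean_cvg0/mean0_irrational.
  by case: wn; exists 1%N; rewrite e expr1n.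
have phq n : c * z ^+ (n + q) * w ^+ ((n + q) ^ 2) = z ^+ q * (c * z ^+ n * w ^+ (n ^ 2)).
  rewrite (_ : ((n + q) ^ 2 = n ^ 2 + q * (2 * n + q))%N); last by ring.
  by rewrite [w ^+ _]exprD exprM wq expr1n exprD; ring.
have [zq|zq] := eqVneq (z ^+ q) 1; last first.
  have L0 : fact_mean (fun k => complex.Re (c * z ^+ k * w ^+ (k ^ 2))) @ \oo --> (0 : R).
    apply: (fact_mean_cvg0 (fun k => c * z ^+ k * w ^+ (k ^ 2))).
    apply: (mean0_of_shift _ q (z ^+ q)) => // n.
    by rewrite normc_phase.
  exists 0; split => // ze _; by rewrite ze expr1n eqxx in zq.
pose f k := complex.Re (c * z ^+ k * w ^+ (k ^ 2)).
exists ((\sum_(k < q) f k) / q%:R); split.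
- by apply: fact_mean_periodic => // n; rewrite /f phq zq mul1r.
- by case; split; exists q.
move=> ze we; rewrite (eq_bigr (fun=> complex.Re c)); last first.
  by move=> k _; rewrite /f ze we !expr1n !mulr1.
rewrite sumr_const card_ord -[_ *+ q]mulr_natr; field.
by rewrite pnatr_eq0 -lt0n.
Qed.

(** Passing to multiples of [m!] replaces [z] and [w] by [z ^ m!] and [w ^ (m! ^ 2)]. If [z] and [w]
    are roots of unity, these powers are 1 for large [m], which removes the Gauss sums; otherwise
    every [L m] is 0. *)
Lemma phase_mean_cvg c z w : normc c = 1 -> normc z = 1 -> normc w = 1 ->
  exists L : nat -> R,
    (forall m, fact_mean (fun k =>
        complex.Re (c * z ^+ (m`! * k) * w ^+ ((m`! * k) ^ 2))) @ \oo --> L m) /\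
    L @ \oo --> (if `[< root_of_unity z /\ root_of_unity w >] then complex.Re c else 0).
Proof.
move=> c1 z1 w1.
have ex m : exists L : R,
  [/\ fact_mean (fun k => complex.Re (c * z ^+ (m`! * k) * w ^+ ((m`! * k) ^ 2))) @ \oo --> L,
     (~ (root_of_unity z /\ root_of_unity w) -> L = 0) &
     (z ^+ m`! = 1 -> w ^+ (m`! ^ 2) = 1 -> L = complex.Re c)].
  have [||L [h1 h2 h3]] := @phase_mean_ex c (z ^+ m`!) (w ^+ (m`! ^ 2)) c1.
  - by rewrite normcX z1 expr1n.
  - by rewrite normcX w1 expr1n.
  exists L; split => //.
  - by under eq_fun do rewrite exprM expnMn exprM.
  - move=> nt; apply: h2 => -[/root_of_unity_rootX rz /root_of_unity_rootX rw].
    by apply: nt; split; [apply: rz|apply: rw]; rewrite ?expn_gt0 fact_gt0.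
have [L hL] := choice ex; exists L; split; first by move=> m; have [] := hL m.
apply: cvg_near_cst.
case: asboolP => [[[q [q0 zq]] [p [p0 wp]]]|nt]; last first.
  by near=> m; have [_ h _] := hL m; exact: h.
near=> m; have [_ _] := hL m; apply.
- have /dvdnP[j ->] : (q %| m`!)%N.
    by apply: dvdn_fact; rewrite q0; near: m; exact: nbhs_infty_ge.
  by rewrite mulnC exprM zq expr1n.
- have /dvdnP[j ->] : (p %| m`!)%N.
    by apply: dvdn_fact; rewrite p0; near: m; exact: nbhs_infty_ge.
  by rewrite expnMn -mulnn mulnA mulnC -mulnA exprM wp expr1n.
Unshelve. all: by end_near. Qed.

End QuadraticLimits.

(** * Bounded functions with vanishing integral *)

Section BoundedIntegrals.
Variables (disp : measure_display) (T : measurableType disp) (R : realType).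
Variable mu : {finite_measure set T -> \bar R}.
Implicit Types f : T -> R.

(** The bound 1 survives means and pointwise limits, and on a finite measure space it supplies the
    dominating function. *)
Definition unit_mfun f := measurable_fun [set: T] f /\ forall x, `|f x| <= 1.

Lemma unit_mfun_integrable f : unit_mfun f -> mu.-integrable [set: T] (EFin \o f).
Proof.
move=> [mf f1]; apply: measurable_bounded_integrable => //.
  by rewrite -ge0_fin_numE //; exact: fin_num_measure.
by exists 1; split => // M M1 x _; apply: le_trans (f1 x) (ltW M1).
Qed.

Lemma Rintegral_sum (J : Type) (r : seq J) (F : J -> T -> R) :
  (forall j, unit_mfun (F j)) ->
  mu.-integrable [set: T] (EFin \o (fun x => \sum_(j <- r) F j x)) /\
  \int[mu]_x (\sum_(j <- r) F j x) = \sum_(j <- r) \int[mu]_x F j x.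
Proof.
move=> FU; elim: r => [|j r [ir IHr]].
  have -> : (fun x : T => \sum_(j <- [::]) F j x) = cst 0.
    by apply/funext => x; rewrite big_nil.
  rewrite big_nil Rintegral_cst // mul0r; split => //.
  by apply: unit_mfun_integrable; split => // x; rewrite normr0.
have -> : (fun x : T => \sum_(i <- j :: r) F i x) =
          (fun x : T => F j x + \sum_(i <- r) F i x).
  by apply/funext => x; rewrite big_cons.
have ij := unit_mfun_integrable _ (FU j).
rewrite big_cons RintegralD // IHr; split => //.
have -> : EFin \o (fun x => F j x + \sum_(i <- r) F i x) =
  ((EFin \o F j) \+ (EFin \o (fun x => \sum_(i <- r) F i x)%R))%E by [].
exact: integrableD.
Qed.

Lemma unit_mfun_mean (J : finType) (F : J -> T -> R) :
  (forall j, unit_mfun (F j)) ->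
  unit_mfun (fun x => (\sum_j F j x) / #|J|%:R) /\
  \int[mu]_x ((\sum_j F j x) / #|J|%:R) = (\sum_j \int[mu]_x F j x) / #|J|%:R.
Proof.
move=> FU; have [is' Is] := Rintegral_sum _ (index_enum J) F FU.
split; last by rewrite RintegralZr // Is.
split.
  apply: measurable_funM => //; apply: measurable_sum => j.
  by have [] := FU j.
move=> x; rewrite normrM normfV normr_nat.
(* For empty [J] the mean is [0 / 0 = 0]. *)
have [->|J0] := eqVneq (#|J|) 0%N; first by rewrite invr0 mulr0 ler01.
rewrite ler_pdivrMr ?ltr0n ?lt0n // mul1r.
apply: (le_trans (ler_norm_sum _ _ _)).
apply: (@le_trans _ _ (\sum_(j : J) 1)); last by rewrite sumr_const.
by apply: ler_sum => j _; have [_] := FU j.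
Qed.

Lemma unit_mfun_cvg (F : nat -> T -> R) f :
  (forall m, unit_mfun (F m)) -> (forall x, F ^~ x @ \oo --> f x) ->
  unit_mfun f /\ (fun m => \int[mu]_x F m x) @ \oo --> \int[mu]_x f x.
Proof.
move=> FU Ff.
have mf : measurable_fun [set: T] f.
  by apply: (measurable_fun_cvg (h := F)) => [m|x _]; [have [] := FU m|exact: Ff].
have f1 x : `|f x| <= 1.
  apply: (@closed_cvg _ _ \oo _ (fun m => `|F m x|) (fun y : R => y <= 1)).
  - exact: closed_le.
  - by apply: nearW => m; have [_] := FU m.
  - exact: cvg_norm.
split; first by split.
have [|||||_ _ c] := @dominated_convergence _ T R mu setT measurableT
  (fun m x => (F m x)%:E) (fun x => (f x)%:E) (cst 1%E).
- by move=> m; apply/measurable_EFinP; have [] := FU m.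
- exact/measurable_EFinP.
- by apply: aeW => x _; apply: cvg_EFin; [exact: nearW|exact: Ff].
- apply: (unit_mfun_integrable (cst 1)); split => // x; by rewrite normr1.
- by apply: aeW => x m _; rewrite lee_fin; have [_] := FU m.
apply: fine_cvg.
rewrite fineK; first exact: c.
apply: integrable_fin_num => //; exact: (unit_mfun_integrable f).
Qed.

(** Closed under means and pointwise limits, this class carries vanishing correlations through the
    iterated averages. *)
Definition null_unit f := unit_mfun f /\ \int[mu]_x f x = 0.

Lemma null_unit_mean (J : finType) (F : J -> T -> R) :
  (forall j, null_unit (F j)) -> null_unit (fun x => (\sum_j F j x) / #|J|%:R).
Proof.
move=> F0; have [|U e] := unit_mfun_mean _ F; first by move=> j; have [] := F0 j.
by split=> //; rewrite e big1 ?mul0r // => j _; have [] := F0 j.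
Qed.

Lemma null_unit_fact_mean (F : nat -> T -> R) N :
  (forall k, null_unit (F k)) -> null_unit (fun x => fact_mean R (fun k => F k x) N).
Proof.
move=> F0; have := null_unit_mean _ (fun k : 'I_(N`!) => F k) (fun k => F0 k).
by rewrite card_ord.
Qed.

Lemma null_unit_cvg (F : nat -> T -> R) f :
  (forall m, null_unit (F m)) -> (forall x, F ^~ x @ \oo --> f x) -> null_unit f.
Proof.
move=> F0 Ff; have [|U c] := unit_mfun_cvg F f _ Ff; first by move=> m; have [] := F0 m.
split => //; apply: (cvg_unique (@norm_hausdorff _ R^o) c).
have -> : (fun m => \int[mu]_x F m x) = cst 0 by apply/funext => m; have [] := F0 m.
exact: cvg_cst.
Qed.

Lemma unit_mfun_cvg_ge (F : nat -> T -> R) f (a : R) :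
  (forall m, unit_mfun (F m)) -> (forall m, a <= \int[mu]_x F m x) ->
  (forall x, F ^~ x @ \oo --> f x) -> unit_mfun f /\ a <= \int[mu]_x f x.
Proof.
move=> FU Fa Ff; have [U c] := unit_mfun_cvg F f FU Ff.
split => //.
apply: (@closed_cvg _ _ \oo _ (fun m => \int[mu]_x F m x) (fun y : R => a <= y)).
- exact: closed_ge.
- exact: nearW.
- exact: c.
Qed.

End BoundedIntegrals.

(** * Transvections acting on integer matrices *)

Section ElementaryConjugation.
Variable n : nat.
Local Notation M := 'M[int]_n.+2.
Local Notation I := 'I_n.+2.
Implicit Types (A B C E : M) (i j k l : I).

Definition letter : Type := (bool * (I * I))%type.

(* With E = delta_mx i j and i != j, the conjugate (1 + m E) A (1 - m E) is
   A + m (E A - A E) - m^2 E A E; the two letters on (i, j) give the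
   coefficients of m and m^2. *)
Definition step (x : letter) A : M :=
  let E := delta_mx x.2.1 x.2.2 in
  if x.1 then E * A - A * E else - (E * A * E).

(** The head letter acts first, so prefixing a letter to a word changes the matrix on which the word
    acts. *)
Definition act (w : seq letter) A : M := foldl (fun B x => step x B) A w.

Definition offdiag (x : letter) : bool := x.2.1 != x.2.2.

Lemma delta_mul3 i j A k l :
  delta_mx i j * A * delta_mx k l = A j k *: delta_mx i l :> M.
Proof.
apply/matrixP => a b; rewrite -!mulmxE !mxE (bigD1 k) //= big1 => [|c ck]; last first.
  by rewrite [X in _ * X]mxE (negbTE ck) mulr0.
rewrite addr0 !mxE eqxx /= (bigD1 j) //= big1 => [|c cj]; last first.
  by rewrite !mxE (negbTE cj) andbF mul0r.
rewrite addr0 !mxE eqxx andbT; case: (a == i); case: (b == l); rewrite /=; ring.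
Qed.

Lemma delta_mul i j k l : delta_mx i j * delta_mx k l = delta_mx i l *+ (j == k) :> M.
Proof. by rewrite -mulmxE mul_delta_mx_cond. Qed.

Lemma stepD x : {morph step x : A B / A + B}.
Proof.
case: x => [[] [i j]] A B; rewrite /step /= ?mulrDr ?mulrDl ?opprD //.
by rewrite !addrA; congr (_ - _); rewrite addrAC.
Qed.

Lemma step0 x : step x 0 = 0.
Proof. by apply: (addrI (step x 0)); rewrite -stepD !addr0. Qed.

Lemma stepMz x A (c : int) : step x (A *~ c) = step x A *~ c.
Proof.
have sN B : step x (- B) = - step x B.
  by apply/eqP; rewrite -addr_eq0 -stepD addNr step0.
have sn B (m : nat) : step x (B *+ m) = step x B *+ m.
  by elim: m => [|m ih]; rewrite ?mulr0n ?step0 // !mulrS stepD ih.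
by case: c => m; rewrite /intmul ?NegzE /= ?sN ?sn.
Qed.

Lemma actD w : {morph act w : A B / A + B}.
Proof. by elim: w => [//|x w ih] A B /=; rewrite /act /= stepD [LHS]ih. Qed.

Lemma act0 w : act w 0 = 0.
Proof. by elim: w => [//|x w ih] /=; rewrite /act /= step0 [LHS]ih. Qed.

Lemma actMn w A (m : nat) : act w (A *+ m) = act w A *+ m.
Proof. by elim: m => [|m ih]; rewrite ?mulr0n ?act0 // !mulrS actD ih. Qed.

Lemma delta_sqr0 i j : i != j -> delta_mx i j * delta_mx i j = 0 :> M.
Proof. by move=> ij; rewrite delta_mul eq_sym (negbTE ij). Qed.

Lemma trace0D A B : trace0 A -> trace0 B -> trace0 (A + B).
Proof. by rewrite /trace0 mxtraceD => -> ->. Qed.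

Lemma trace0N A : trace0 A -> trace0 (- A).
Proof. by rewrite /trace0 raddfN /= => ->; rewrite oppr0. Qed.

Lemma trace0B A B : trace0 A -> trace0 B -> trace0 (A - B).
Proof. by move=> A0 B0; apply: trace0D => //; exact: trace0N. Qed.

Lemma trace0Mn A (m : nat) : trace0 A -> trace0 (A *+ m).
Proof. by rewrite /trace0 raddfMn /= => ->; rewrite mul0rn. Qed.

Lemma trace00 : trace0 (0 : M). Proof. exact: mxtrace0. Qed.

Lemma trace0_step x A : offdiag x -> trace0 (step x A).
Proof.
case: x => [[] [i j]] /= ij; rewrite /trace0 /step /=.
  by rewrite raddfB /= -!mulmxE mxtrace_mulC subrr.
rewrite raddfN /= -!mulmxE mxtrace_mulC !mulmxE mulrA.
by rewrite delta_sqr0 // mul0r mxtrace0 oppr0.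
Qed.

Lemma trace0_act w A : all offdiag w -> trace0 A -> trace0 (act w A).
Proof.
by elim: w A => [//|x w ih] A /= /andP[ox ow] A0; apply: ih => //; exact: trace0_step.
Qed.

Definition transvect i j (m : nat) A : M :=
  (1 + delta_mx i j *+ m) * A * (1 - delta_mx i j *+ m).

Lemma transvectE i j m A : i != j ->
  transvect i j m A = A + step (true, (i, j)) A *+ m + step (false, (i, j)) A *+ m ^ 2.
Proof.
move=> ij; rewrite /transvect /step /=; set E := delta_mx i j.
rewrite mulrDl mul1r mulrBr mulr1 mulrDl !mulrnAl !mulrnAr -!mulrA -mulrnA mulnn.
rewrite mulrnBl mulNrn opprD !addrA; congr (_ - _); congr (_ - _).
Qed.

(** Conjugacy under the special linear group, [A = g C g^-1], written without inverses. *)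
Definition orbit C A := exists g : M, \det g = 1 /\ A *m g = g *m C.

Lemma orbit_refl C : orbit C C.
Proof. by exists 1%:M; rewrite det1 mulmx1 mul1mx. Qed.

(** Below the diagonal the matrix is triangular with unit diagonal; the other case follows by
    transposition. *)
Lemma det_transvection i j (m : nat) : i != j -> \det (1 + delta_mx i j *+ m : M) = 1.
Proof.
have low (a b : I) : (b < a)%N -> \det (1 + delta_mx a b *+ m : M) = 1.
  move=> ba; rewrite det_trig; last first.
    apply/is_trig_mxP => k l kl; rewrite !mxE; rewrite mulmxnE !mxE.
    have -> : (k == l) = false by apply/negbTE/eqP => e; rewrite e ltnn in kl.
    rewrite add0r; case: eqP => [ka|]; rewrite /= ?mul0rn //.
    case: eqP => [lb|]; last by rewrite mul0rn.
    by move: ba; rewrite -ka -lb ltnNge (ltnW kl).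
  apply: big1 => k _; rewrite !mxE mulmxnE !mxE eqxx.
  case: eqP => [ka|] /=; last by rewrite mul0rn addr0.
  case: eqP => [kb|] /=; last by rewrite mul0rn addr0.
  by rewrite -ka -kb ltnn in ba.
rewrite neq_ltn => /orP[ij|ji]; last exact: low.
rewrite -det_tr raddfD /= raddfMn /= trmx_delta.
by rewrite [X in X + _](_ : _ = 1) ?low //; exact: trmx1.
Qed.

Lemma transvection_inv i j (m : nat) : i != j ->
  (1 - delta_mx i j *+ m) * (1 + delta_mx i j *+ m) = 1 :> M.
Proof.
move=> ij; rewrite mulrBl mul1r mulrDr mulr1 mulrnAl mulrnAr delta_sqr0 //.
by rewrite !mul0rn addr0 addrK.
Qed.

Lemma orbit_transvect C A i j m : i != j -> orbit C A -> orbit C (transvect i j m A).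
Proof.
move=> ij [g [dg Ag]]; exists ((1 + delta_mx i j *+ m) * g); split.
  by rewrite -mulmxE det_mulmx dg det_transvection // mulr1.
rewrite mulmxE in Ag *; rewrite /transvect -!mulrA; congr (_ * _).
by rewrite [X in _ * X]mulrA transvection_inv // mul1r.
Qed.

Lemma orbit_trace0 C A : orbit C A -> trace0 C -> trace0 A.
Proof.
move=> [g [dg Ag]] C0.
have ug : g \in unitmx by rewrite unitmxE dg unitr1.
rewrite /trace0 -(mulmxK ug A) Ag mxtrace_mulC mulmxA mulVmx // mul1mx.
exact: C0.
Qed.

(** Nonzero multiples are allowed because a character value with a root of unity as nonzero power is
    itself one. Words are nonempty since lists of words grow by prefixing letters. *)
Definition reachable A B := exists w,
  [/\ all offdiag w, w != [::] & exists c : int, c != 0 /\ act w A = B *~ c].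

Lemma reachable_step A B B' x (c : int) : reachable A B -> offdiag x -> c != 0 ->
  step x B = B' *~ c -> reachable A B'.
Proof.
move=> [w [ow w0 [b [b0 wb]]]] ox c0 xB; exists (rcons w x); split.
- by rewrite all_rcons ox.
- by case: (w).
- exists (c * b); split; first by rewrite mulf_neq0.
  by rewrite /act foldl_rcons -/(act w A) wb stepMz xB mulrzA.
Qed.

(** Uses the commutator [[E_jl, E_ij] = - E_il]. *)
Lemma reachable_col A i j l : i != j -> l != i -> reachable A (delta_mx i j) ->
  reachable A (delta_mx i l).
Proof.
move=> ij li rA; have [->//|lj] := eqVneq l j.
apply: (reachable_step _ _ _ (true, (j, l)) (-1) rA); rewrite /offdiag //= 1?eq_sym //.
by rewrite /step /= !delta_mul eqxx (negbTE li) /= mulr0n mulr1n sub0r mulrN1z.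
Qed.

Lemma reachable_row A i j k : i != j -> k != j -> reachable A (delta_mx i j) ->
  reachable A (delta_mx k j).
Proof.
move=> ij kj rA; have [->//|ki] := eqVneq k i.
apply: (reachable_step _ _ _ (true, (k, i)) 1 rA); rewrite /offdiag //=.
by rewrite /step /= !delta_mul eqxx [j == k]eq_sym (negbTE kj) /= mulr0n mulr1n subr0 mulr1z.
Qed.

(** From [E_ji E_ij E_ji = E_ji]. This quadratic letter is indispensable for 2 x 2 matrices, where
    the row and column moves have no third index to use. *)
Lemma reachable_tr A i j : i != j -> reachable A (delta_mx i j) -> reachable A (delta_mx j i).
Proof.
move=> ij rA; apply: (reachable_step _ _ _ (false, (j, i)) (-1) rA); rewrite /offdiag //= 1?eq_sym //.
by rewrite /step /= !delta_mul !eqxx /= mulr1n delta_mul eqxx mulr1n mulrN1z.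
Qed.

Lemma reachable_delta A i j k l : i != j -> k != l ->
  reachable A (delta_mx i j) -> reachable A (delta_mx k l).
Proof.
move=> ij kl rA; have [ki|ki] := eqVneq k i.
  by subst k; apply: (reachable_col _ _ j) => //; rewrite eq_sym.
have [li|li] := eqVneq l i.
  subst l; apply: reachable_tr; first by rewrite eq_sym.
  exact: (reachable_col _ _ j).
apply: (reachable_row _ i) => //; first by rewrite eq_sym.
exact: (reachable_col _ _ j).
Qed.

(** Indexing by all pairs makes the generator at [(0, 0)] the zero matrix. *)
Definition gen (p : I * I) : M :=
  if p.1 == p.2 then delta_mx p.1 p.1 - delta_mx 0 0 else delta_mx p.1 p.2.

Lemma trace0_gen p : trace0 (gen p).
Proof.
have td (i : I) : \tr (delta_mx i i : M) = 1.
  rewrite /mxtrace (bigD1 i) //= mxE !eqxx big1 ?addr0 // => k ki.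
  by rewrite mxE (negbTE ki).
rewrite /trace0 /gen; case: eqP => [_|/eqP ij]; first by rewrite raddfB /= !td subrr.
by rewrite /mxtrace big1 // => k _; rewrite mxE; case: eqP => // ->; rewrite (negbTE ij).
Qed.

(** An entry [C i j != 0] off the diagonal gives [- C i j E_ji] by a quadratic letter; if [C] is
    diagonal, [C i i != C 0 0] gives [(C 0 0 - C i i) E_i0] by a commutator. From one elementary
    matrix all others follow, and [[E_p0, E_0p] = E_pp - E_00]. *)
Lemma reachable_gen C p : trace0 C -> C != 0 -> gen p = 0 \/ reachable C (gen p).
Proof.
move=> C0 Cn0.
have [i [j [ij rij]]] : exists i j, i != j /\ reachable C (delta_mx i j).
  have start x (B : M) (c : int) : offdiag x -> c != 0 -> step x C = B *~ c -> reachable C B.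
    by move=> ox c0 e; exists [:: x]; split; rewrite /= ?ox //; exists c.
  have [[i [j [ij Cij]]]|Cdiag] := pselect (exists i j, i != j /\ C i j != 0).
    exists j, i; split; first by rewrite eq_sym.
    apply: (start (false, (j, i)) _ (- C i j)); rewrite /offdiag ?oppr_eq0 //= 1?eq_sym //.
    by rewrite /step /= delta_mul3 -scaler_int intz scaleNr.
  have {}Cdiag i j : i != j -> C i j = 0.
    by move=> ij; apply/eqP; apply: contrapT => /negP Cij; apply: Cdiag; exists i, j.
  (* A scalar matrix of trace zero over the integers vanishes. *)
  have [i Cii] : exists i, C i i != C 0 0.
    apply: contrapT => Cs; move/eqP: Cn0; apply.
    have {}Cs i : C i i = C 0 0.
      by apply/eqP; apply: contrapT => /negP h; apply: Cs; exists i.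
    have C00 : C 0 0 = 0.
      move: C0; rewrite /trace0 /mxtrace (eq_bigr (fun=> C 0 0)); last by move=> i _; exact: Cs.
      by rewrite sumr_const card_ord => /eqP; rewrite mulrn_eq0 /= => /eqP.
    apply/matrixP => i j; rewrite mxE; have [->|/Cdiag//] := eqVneq i j.
    by rewrite Cs.
  have i0 : i != 0 by apply: contra_neq Cii => ->.
  exists i, 0; split => //.
  apply: (start (true, (i, 0)) _ (C 0 0 - C i i)) => //.
    by rewrite subr_eq0 eq_sym.
  rewrite /step /=; apply/matrixP => a b; rewrite -!mulmxE.
  rewrite -scaler_int.
  rewrite !mxE (bigD1 0) //= big1 => [|c c0]; last by rewrite mxE (negbTE c0) andbF mul0r.
  rewrite (bigD1 i) //= big1 => [|c ci]; last by rewrite [X in _ * X]mxE (negbTE ci) mulr0.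
  rewrite !mxE !eqxx !addr0 andbT /= intz.
  have [->|ai] := eqVneq a i; have [->|b0] := eqVneq b 0; rewrite /= ?mulr0 ?mul0r ?subr0 ?mulr1 ?mul1r //.
  - by rewrite Cdiag // eq_sym.
  - by rewrite Cdiag // sub0r oppr0.
rewrite /gen; case: eqP => [_|/eqP pp]; last by right; exact: (reachable_delta _ i j).
have [->|p0] := eqVneq p.1 0; first by left; rewrite subrr.
right; have r0 : reachable C (delta_mx 0 p.1).
  by apply: (reachable_delta _ i j) => //; rewrite eq_sym.
apply: (reachable_step _ _ _ (true, (p.1, 0)) 1 r0) => //.
by rewrite /step /= !delta_mul !eqxx !mulr1n mulr1z.
Qed.

(** The surplus multiples of [delta_mx 0 0] from the diagonal generators add up to the trace. *)
Lemma gen_sum A : trace0 A -> A = \sum_(p : I * I) gen p *~ A p.1 p.2.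
Proof.
move=> A0; rewrite -(pair_bigA _ (fun i j => gen (i, j) *~ A i j)) /=.
have gE i j : gen (i, j) *~ A i j =
    A i j *: delta_mx i j - (if i == j then A i i *: delta_mx 0 0 else 0).
  rewrite -scaler_int intz /gen /=; case: eqP => [->|_]; last by rewrite subr0.
  by rewrite scalerBr.
have rowE i : \sum_j gen (i, j) *~ A i j =
    \sum_j A i j *: delta_mx i j - A i i *: delta_mx 0 0.
  rewrite (eq_bigr _ (fun j _ => gE i j)) sumrB; congr (_ - _).
  by rewrite -big_mkcond (big_pred1 i) // => j; rewrite /= eq_sym.
rewrite (eq_bigr _ (fun i _ => rowE i)).
rewrite sumrB -matrix_sum_delta -scaler_suml.
by have -> : \sum_i A i i = 0 by []; rewrite scale0r subr0.
Qed.

(** Meant for properties of character values: a character turns differences into quotients, so only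
    the generators need a separate check. *)
Lemma gen_ind (P : M -> Prop) : P 0 ->
  (forall A B, trace0 A -> trace0 B -> P A -> P B -> P (A - B)) ->
  (forall p, P (gen p)) -> forall A, trace0 A -> P A.
Proof.
move=> P0 PB Pg A A0.
have PN B : trace0 B -> P B -> P (- B).
  by move=> B0 PB'; rewrite -sub0r; apply: PB => //; exact: trace00.
have PD B B' : trace0 B -> trace0 B' -> P B -> P B' -> P (B + B').
  move=> B0 B'0 p p'; rewrite -[B']opprK; apply: PB => //; first exact: trace0N.
  exact: PN.
have Pz B (c : int) : trace0 B -> P B -> trace0 (B *~ c) /\ P (B *~ c).
  move=> B0 p.
  have Pn (m : nat) : P (B *+ m).
    by elim: m => [//|m ih]; rewrite mulrS; apply: PD => //; exact: trace0Mn.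
  case: c => m; rewrite /intmul; first by split; [exact: trace0Mn|].
  by split; [exact/trace0N/trace0Mn|apply: PN => //; exact: trace0Mn].
rewrite (gen_sum A A0).
suff [] : trace0 (\sum_(p : I * I) gen p *~ A p.1 p.2) /\
          P (\sum_(p : I * I) gen p *~ A p.1 p.2) by [].
elim/big_ind: _ => [|B B' [t p] [t' p']|p _]; first by split=> //; exact: trace00.
- by split; [exact: trace0D|exact: PD].
- by apply: Pz => //; exact: trace0_gen.
Qed.

End ElementaryConjugation.

(** * Characters along conjugacy classes *)

Section Characters.
Variables (R : realType) (n : nat).
Local Notation M := 'M[int]_n.+2.
Local Notation I := 'I_n.+2.
Implicit Types (A B C : M) (chi : dual R n.+2).

Definition cval chi A : R[i] := Complex (chval R n.+2 chi A).1 (chval R n.+2 chi A).2.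

Lemma cval_norm chi A : trace0 A -> normc (cval chi A) = 1.
Proof.
by move=> A0; have [h _ _] := chvalP _ _ chi; rewrite /cval /= h // sqrtr1.
Qed.

Lemma cval_neq0 chi A : trace0 A -> cval chi A != 0.
Proof. by move=> A0; apply: normc_neq0; exact: cval_norm. Qed.

Lemma cvalD chi A B : trace0 A -> trace0 B -> cval chi (A + B) = cval chi A * cval chi B.
Proof.
by move=> A0 B0; have [_ h _] := chvalP _ _ chi; rewrite /cval h.
Qed.

Lemma cval0 chi : cval chi 0 = 1.
Proof.
have t0 := trace00 n; apply: (mulfI (cval_neq0 chi 0 t0)).
by rewrite -cvalD // addr0 mulr1.
Qed.

Lemma cvalN chi A : trace0 A -> cval chi (- A) = (cval chi A)^-1.
Proof.
move=> A0; apply: (mulfI (cval_neq0 chi A A0)).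
by rewrite -cvalD ?subrr ?cval0 ?divff ?cval_neq0 //; exact: trace0N.
Qed.

Lemma cvalB chi A B : trace0 A -> trace0 B -> cval chi (A - B) = cval chi A / cval chi B.
Proof. by move=> A0 B0; rewrite cvalD ?cvalN //; exact: trace0N. Qed.

Lemma cvalMn chi A (m : nat) : trace0 A -> cval chi (A *+ m) = cval chi A ^+ m.
Proof.
move=> A0; elim: m => [|m ih]; first by rewrite mulr0n cval0.
by rewrite mulrS cvalD ?ih ?exprS //; exact: trace0Mn.
Qed.

Lemma root_of_unity_cvalMz chi A (c : int) : trace0 A -> c != 0 ->
  root_of_unity R (cval chi (A *~ c)) -> root_of_unity R (cval chi A).
Proof.
move=> A0; case: c => m c0; rewrite /intmul.
  rewrite cvalMn //; apply: root_of_unity_rootX.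
  by rewrite lt0n; apply: contra_neq c0 => ->.
rewrite cvalN; last exact: trace0Mn.
move=> /root_of_unityV; rewrite invrK cvalMn //.
exact: root_of_unity_rootX.
Qed.

Lemma cval_quadratic chi A B C (m k : nat) : trace0 A -> trace0 B -> trace0 C ->
  cval chi (A + B *+ m + C *+ k) = cval chi A * cval chi B ^+ m * cval chi C ^+ k.
Proof.
move=> A0 B0 C0; have Bm := trace0Mn n B m B0; have Ck := trace0Mn n C k C0.
by rewrite !cvalD ?cvalMn //; exact: trace0D.
Qed.

Lemma cval_transvect chi i j (m : nat) A : i != j -> trace0 A ->
  cval chi (transvect n i j m A) =
  cval chi A * cval chi (step n (true, (i, j)) A) ^+ m
             * cval chi (step n (false, (i, j)) A) ^+ (m ^ 2).
Proof.
move=> ij A0; have t b : trace0 (step n (b, (i, j)) A) by apply: trace0_step.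
by rewrite transvectE // cval_quadratic.
Qed.

Lemma act_transvect w i j (m : nat) A : i != j ->
  act n w (transvect n i j m A) =
  act n w A + act n w (step n (true, (i, j)) A) *+ m
            + act n w (step n (false, (i, j)) A) *+ m ^ 2.
Proof. by move=> ij; rewrite transvectE // actD actD actMn actMn. Qed.

Lemma measurable_cval A :
  measurable_fun [set: dual R n.+2] (fun chi => complex.Re (cval chi A)) /\
  measurable_fun [set: dual R n.+2] (fun chi => complex.Im (cval chi A)).
Proof.
split=> _ Y mY; rewrite setTI; apply: sub_sigma_algebra; exists A, Y; split => //.
- by left.
- by right.
Qed.

Lemma unit_mfun_Re_cval A : trace0 A ->
  unit_mfun _ (dual R n.+2) R (fun chi => complex.Re (cval chi A)).
Proof.
move=> A0; split; first by have [] := measurable_cval A.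
by move=> chi; rewrite -(cval_norm chi A A0) Re_le_normc.
Qed.

Definition rational_on (D : seq (seq (letter n))) A chi : Prop :=
  forall w, w \in D -> root_of_unity R (cval chi (act n w A)).

(** For the empty list the condition is vacuous, so the induction starts from the integrand of the
    correlations. *)
Definition rational_part (D : seq (seq (letter n))) A chi : R :=
  if `[< rational_on D A chi >] then complex.Re (cval chi A) else 0.

(** These words are the conditions left by averaging over transvections on [(i, j)]: the added
    [[::]] accounts for the phase of the character itself, the rest for the phases along the words
    of [D]. *)
Definition next_words (i j : I) (D : seq (seq (letter n))) :=
  D ++ [seq (true, (i, j)) :: w | w <- [::] :: D]
    ++ [seq (false, (i, j)) :: w | w <- [::] :: D].

Lemma rational_on_next i j D A chi :
  rational_on (next_words i j D) A chi <->
  [/\ root_of_unity R (cval chi (step n (true, (i, j)) A)),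
      root_of_unity R (cval chi (step n (false, (i, j)) A)) &
      forall w, w \in D -> [/\ root_of_unity R (cval chi (act n w A)),
         root_of_unity R (cval chi (act n w (step n (true, (i, j)) A))) &
         root_of_unity R (cval chi (act n w (step n (false, (i, j)) A)))]].
Proof.
rewrite /next_words; split=> [H|[H1 H2 H3] w].
  have Hb b w : w \in [::] :: D -> root_of_unity R (cval chi (act n w (step n (b, (i, j)) A))).
    move=> wD; apply: (H ((b, (i, j)) :: w)); rewrite !mem_cat.
    by case: b; rewrite (map_f (cons _)) ?orbT.
  split; [exact: (Hb true [::])|exact: (Hb false [::])|move=> w wD].
  by split; [apply: H|apply: Hb|apply: Hb]; rewrite ?mem_cat ?inE wD ?orbT.
rewrite !mem_cat => /or3P[/H3[]//|/mapP[v]|/mapP[v]];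
  by rewrite inE => /orP[/eqP->|/H3[? ? ?]] ->.
Qed.

Lemma act_phase_rational w i j chi A m : i != j -> all (offdiag n) w -> trace0 A ->
  cval chi (act n w (transvect n i j m A)) =
  cval chi (act n w A) * cval chi (act n w (step n (true, (i, j)) A)) ^+ m
             * cval chi (act n w (step n (false, (i, j)) A)) ^+ (m ^ 2).
Proof.
move=> ij ow A0.
have t b : trace0 (act n w (step n (b, (i, j)) A)) by apply/trace0_act/trace0_step.
have tA : trace0 (act n w A) by exact: trace0_act.
by rewrite act_transvect // cval_quadratic.
Qed.

(** If along some word of [D] a coefficient of the phase is not a root of unity, all but finitely
    many terms vanish. Otherwise every transvect satisfies the condition [D], and the mean is that
    of the pure phase. *)
Lemma rational_part_mean i j D A chi : i != j -> all (all (offdiag n)) D -> trace0 A ->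
  exists L : nat -> R,
  (forall m, fact_mean R (fun k =>
      rational_part D (transvect n i j (m`! * k) A) chi) @ \oo --> L m) /\
  L @ \oo --> rational_part (next_words i j D) A chi.
Proof.
move=> ij oD A0.
have tb b : trace0 (step n (b, (i, j)) A) by exact: trace0_step.
have [H|/existsNP[w /not_implyP[wD nw]]] := pselect (forall w, w \in D ->
   [/\ root_of_unity R (cval chi (act n w A)),
       root_of_unity R (cval chi (act n w (step n (true, (i, j)) A))) &
       root_of_unity R (cval chi (act n w (step n (false, (i, j)) A)))]); last first.
  have -> : rational_part (next_words i j D) A chi = 0.
    rewrite /rational_part; case: asboolP => // /rational_on_next[_ _ /(_ w wD)].
    by [].
  exists (fun=> 0); split; last exact: cvg_cst.
  have ow := allP oD w wD.
  have tw b : trace0 (act n w (step n (b, (i, j)) A)) by exact: trace0_act.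
  move=> m; have [||||N0 hN0] := phase_eventually_irrational R _ _ _ m`! _ _ _ _ nw.
  - exact: fact_gt0.
  - by apply/cval_neq0/trace0_act.
  - exact: cval_neq0.
  - exact: cval_neq0.
  apply: (fact_mean_cvg_finsupp _ _ N0) => k /hN0 hk.
  rewrite /rational_part; case: asboolP => // /(_ w wD).
  by rewrite act_phase_rational.
have [|||L [hL1 hL2]] := phase_mean_cvg R (cval chi A)
  (cval chi (step n (true, (i, j)) A)) (cval chi (step n (false, (i, j)) A));
  rewrite ?cval_norm //.
exists L; split.
  move=> m; rewrite (_ : (fun k => rational_part _ _ _) = (fun k => complex.Re
    (cval chi A * cval chi (step n (true, (i, j)) A) ^+ (m`! * k) *
     cval chi (step n (false, (i, j)) A) ^+ ((m`! * k) ^ 2)))); first exact: hL1.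
  apply/funext => k; rewrite /rational_part asboolT.
    by rewrite cval_transvect.
  move=> w wD; have [r1 r2 r3] := H w wD.
  rewrite act_phase_rational ?(allP oD) //.
  by do ?apply: root_of_unityM => //; exact: root_of_unityX.
rewrite /rational_part.
have -> : `[< rational_on (next_words i j D) A chi >] = `[< root_of_unity R
   (cval chi (step n (true, (i, j)) A)) /\ root_of_unity R (cval chi (step n (false, (i, j)) A)) >].
  by apply: asbool_equiv_eq; rewrite rational_on_next; split => [[]|[]].
exact: hL2.
Qed.

(** * Propagation of vanishing integrals along words *)

Section NullParts.
Variables (nu : {finite_measure set dual R n.+2 -> \bar R}) (C : M).
Hypothesis trC : trace0 C.

(** The whole conjugacy class is included because averaging passes from a matrix to its
    transvects. *)
Definition all_null D := all (all (offdiag n)) D /\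
  forall A, orbit n C A -> null_unit _ _ R nu (rational_part D A).

(** Two limits, first in the length of the mean and then in [m], both by dominated convergence. *)
Lemma all_null_next i j D : i != j -> all_null D -> all_null (next_words i j D).
Proof.
move=> ij [oD ND]; split.
  apply/allP => w; rewrite !mem_cat => /or3P[/(allP oD)//|/mapP[v]|/mapP[v]];
    by rewrite inE => /orP[/eqP->|/(allP oD) ov] ->; rewrite /= /offdiag /= ij.
move=> A OA; have A0 := orbit_trace0 _ _ _ OA trC.
have [L hL] := choice (fun chi => rational_part_mean i j D A chi ij oD A0).
apply: (null_unit_cvg _ _ _ _ (fun m chi => L chi m)); last by move=> chi; have [] := hL chi.
move=> m; apply: (null_unit_cvg _ _ _ _ (fun N chi => fact_mean R (fun k =>
      rational_part D (transvect n i j (m`! * k) A) chi) N)).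
  move=> N; apply: null_unit_fact_mean => k; apply: ND.
  exact: orbit_transvect.
by move=> chi; have [] := hL chi.
Qed.

(** Letters are adjoined from the last to the first, since [next_words] prefixes them. *)
Lemma all_null_word w D : w != [::] -> all (offdiag n) w -> all_null D ->
  exists D', [/\ all_null D', {subset D <= D'} & w \in D'].
Proof.
elim: w D => [//|[b [i j]] w ih] D _ /= /andP[ij ow] ND.
have mem (D1 : seq (seq (letter n))) : w \in [::] :: D1 ->
    (b, (i, j)) :: w \in next_words i j D1.
  move=> h; rewrite !mem_cat.
  by case: (b); rewrite (map_f (cons _)) ?orbT.
have sub (D1 : seq (seq (letter n))) : {subset D1 <= next_words i j D1}.
  by move=> v vD; rewrite mem_cat vD.
have [w0|w0] := eqVneq w [::].
  by exists (next_words i j D); split; [exact: all_null_next|exact: sub|apply: mem; rewrite w0 inE eqxx].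
have [D1 [ND1 sD1 wD1]] := ih D w0 ow ND.
exists (next_words i j D1); split; first exact: all_null_next.
- by move=> v /sD1 /sub.
- by apply: mem; rewrite inE wD1 orbT.
Qed.

Lemma all_null_gens : C != 0 -> all_null [::] ->
  exists D, all_null D /\
    forall p, gen n p = 0 \/ exists w c, [/\ w \in D, c != 0 & act n w C = gen n p *~ c].
Proof.
move=> C0 N0.
suff H (s : seq (I * I)) : exists D, all_null D /\ forall p, p \in s ->
   gen n p = 0 \/ exists w c, [/\ w \in D, c != 0 & act n w C = gen n p *~ c].
  have [D [ND hD]] := H (enum {: I * I}); exists D; split => // p.
  by apply: hD; rewrite mem_enum.
elim: s => [|p s [D [ND hD]]]; first by exists [::].
have [p0|[w [ow w0 [c [c0 e]]]]] := reachable_gen n C p trC C0.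
  by exists D; split => // q; rewrite inE => /orP[/eqP->|/hD//]; left.
have [D' [ND' sD' wD']] := all_null_word w D w0 ow ND.
exists D'; split => // q; rewrite inE => /orP[/eqP->|/hD[->|[v [b [vD b0 ev]]]]].
- by right; exists w, c.
- by left.
- by right; exists v, b; split => //; exact: sD'.
Qed.

End NullParts.

(** * Characters of finite order *)

Definition trivial_on_trace0 chi := forall A, trace0 A -> cval chi A = 1.

Lemma trivial_on_gens chi : (forall p, cval chi (gen n p) = 1) -> trivial_on_trace0 chi.
Proof.
move=> H; apply: gen_ind => // [|A B A0 B0 a b]; first exact: cval0.
by rewrite cvalB // a b divr1.
Qed.

Lemma cpowE (a : R * R) (q : nat) :
  Complex (cpow R a q).1 (cpow R a q).2 = Complex a.1 a.2 ^+ q.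
Proof. by elim: q => [//|q ih]; rewrite exprS -ih. Qed.

(** The product of the exponents at the finitely many generators is a common exponent. *)
Lemma finite_order_of_gens chi : (forall p, root_of_unity R (cval chi (gen n p))) ->
  exists q : nat, (0 < q)%N /\ forall A, trace0 A -> cval chi A ^+ q = 1.
Proof.
move=> H; have [q hq] := choice H.
exists (\prod_p q p)%N; split; first by rewrite prodn_gt0 // => p; have [] := hq p.
apply: gen_ind => [|A B A0 B0 a b|p]; first by rewrite cval0 expr1n.
- by rewrite cvalB // expr_div_n a b divr1.
- by rewrite (bigD1 p) //= exprM; have [_ ->] := hq p; rewrite expr1n.
Qed.

Lemma cval_one chi A : cval chi A = 1 -> chval R n.+2 chi A = (1, 0).
Proof. by rewrite /cval; case: (chval R n.+2 chi A) => x y /= [-> ->]. Qed.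

Lemma nontrivial_finite_orderP chi : nontrivial_finite_order R n.+2 chi <->
  ~ trivial_on_trace0 chi /\
  exists q : nat, (0 < q)%N /\ forall A, trace0 A -> cval chi A ^+ q = 1.
Proof.
have pE A q : cpow R (chval R n.+2 chi A) q = (1, 0) <-> cval chi A ^+ q = 1.
  rewrite /cval -cpowE; case: (cpow _ _ _) => x y /=.
  by split => [[-> ->]|[-> ->]].
split=> [[[A [A0 nA]] [q [q0 hq]]]|[nt [q [q0 hq]]]].
  split; first by move=> /(_ A A0)/cval_one.
  by exists q; split => // B /hq/pE.
split; last by exists q; split => // B /hq/pE.
apply: contrapT => H; apply: nt => A A0; apply: contrapT => nA; apply: H.
by exists A; split => // e; apply: nA; rewrite /cval e.
Qed.

Lemma character_ext chi chi' : (forall p, cval chi (gen n p) = cval chi' (gen n p)) ->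
  chval R n.+2 chi = chval R n.+2 chi'.
Proof.
move=> H; apply/funext => A.
have [A0|nA] := pselect (trace0 A); last first.
  by have [_ _ ->] := chvalP _ _ chi => //; have [_ _ ->] := chvalP _ _ chi'.
have : cval chi A = cval chi' A.
  move: A A0; apply: gen_ind => // [|A B A0 B0 a b]; first by rewrite !cval0.
  by rewrite !cvalB // a b.
by rewrite /cval; case: (chval R n.+2 chi A) (chval R n.+2 chi' A) => [x y] [x' y'] /= [-> ->].
Qed.

(** Values at the finitely many generators determine a character, so the set is a finite
    intersection of level sets of evaluations. *)
Lemma measurable_character_singleton chi0 :
  measurable [set chi : dual R n.+2 | chval R n.+2 chi = chval R n.+2 chi0].
Proof.
pose S p (g : R[i] -> R) := [set chi : dual R n.+2 | g (cval chi (gen n p)) = g (cval chi0 (gen n p))].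
have mS p g : measurable_fun [set: dual R n.+2] (fun chi => g (cval chi (gen n p))) ->
    measurable (S p g).
  move=> mg; have -> : S p g = (fun chi => g (cval chi (gen n p))) @^-1`
      [set g (cval chi0 (gen n p))] by [].
  by rewrite -[X in measurable X]setTI; apply: mg.
have -> : [set chi : dual R n.+2 | chval R n.+2 chi = chval R n.+2 chi0] =
   \big[setI/setT]_(p : I * I) (S p (@complex.Re R) `&` S p (@complex.Im R)).
  rewrite -bigcap_seq; apply/seteqP; split => [chi /= e p _|chi /= H].
    by rewrite /S /= /cval e.
  apply: character_ext => p; have [] := H p; first by rewrite /= mem_index_enum.
  by rewrite /S /= => e1 e2; apply/eqP; rewrite eq_complex /= e1 e2 !eqxx.
apply: bigsetI_measurable => p _; have [m1 m2] := measurable_cval (gen n p).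
by apply: measurableI; exact: mS.
Qed.

Lemma roots_of_unity_seq (q : nat) : (0 < q)%N ->
  exists s : seq R[i], forall z, z ^+ q = 1 -> z \in s.
Proof.
move=> q0; have [s e] := closed_field_poly_normal ('X^q - 1 : {poly R[i]}).
exists s => z zq; rewrite -root_prod_XsubC.
have : root ('X^q - 1 : {poly R[i]}) z by rewrite /root !(hornerE, hornerXn) zq subrr.
by rewrite {1}e rootZ // lead_coef_eq0 -size_poly_eq0 size_XnsubC.
Qed.

(* There are only countably many characters of finite order: such a character
   is determined by its values on the generators, which are roots of unity. *)
Lemma finite_order_negligible (nu : {finite_measure set dual R n.+2 -> \bar R}) :
  no_finite_order_atoms R n.+2 nu ->
  nu.-negligible [set chi | nontrivial_finite_order R n.+2 chi].
Proof.
move=> Hnu.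
have ex (q : nat) : exists s : seq R[i], (0 < q)%N -> forall z, z ^+ q = 1 -> z \in s.
  have [->|q0] := posnP q; first by exists [::].
  by have [s hs] := roots_of_unity_seq q q0; exists s.
have [rts hrts] := choice ex.
(* A code is an exponent together with a table of positions in the list of its roots of unity; it
   describes at most one character. *)
pose S (x : nat * 'M[nat]_n.+2) := [set chi : dual R n.+2 |
  nontrivial_finite_order R n.+2 chi /\
  forall p, cval chi (gen n p) = nth 0 (rts x.1) (x.2 p.1 p.2)].
have NS x : nu.-negligible (S x).
  have [[chi0 S0]|S0] := pselect (exists chi, S x chi); last first.
    have -> : S x = set0 by apply/seteqP; split => // chi h; apply: S0; exists chi.
    exact: negligible_set0.
  apply: (@negligibleS _ _ _ _ [set chi : dual R n.+2 | chval R n.+2 chi = chval R n.+2 chi0]).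
    by move=> chi [_ h]; apply: character_ext => p; rewrite h; have [_ ->] := S0.
  apply/negligibleP; first exact: measurable_character_singleton.
  by apply: Hnu; have [] := S0.
pose X : countType := (nat * 'M[nat]_n.+2)%type.
pose F (k : nat) := if choice.unpickle k is Some x then S (x : X) else classical_sets.set0.
apply: (@negligibleS _ _ _ _ (\bigcup_k F k)%classic); last first.
  by apply: negligible_bigcup => k; rewrite /F; case: choice.unpickle => //; exact: negligible_set0.
move=> chi /= hchi; have /nontrivial_finite_orderP[_ [q [q0 hq]]] := hchi.
pose x : X := (q, \matrix_(i, j) index (cval chi (gen n (i, j))) (rts q)).
exists (choice.pickle x) => //.
rewrite /F choice.pickleK; split => // -[i j]; rewrite /x /= mxE nth_index //.
by apply: hrts => //; apply: hq; exact: trace0_gen.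
Qed.

End Characters.

(** * The mass of the trivial character *)

Section PairCorrelations.
Variables (disp : measure_display) (T : measurableType disp) (R : realType).
Variable eta : {finite_measure set T -> \bar R}.

Lemma unit_mfun_indic (S : set T) : measurable S -> unit_mfun _ T R (\1_S).
Proof.
move=> mS; split; first exact: measurable_indic.
by move=> x; rewrite indicE normr_nat lern1 leq_b1.
Qed.

Lemma Rintegral_indic (S : set T) : measurable S -> \int[eta]_x (\1_S x : R) = fine (eta S).
Proof. by move=> mS; rewrite /Rintegral integral_indic // setIT. Qed.

(* This is the nonnegativity of the variance of the mean of the indicators. *)
Lemma pair_correlation_ge (J : finType) (S : J -> set T) (c : R) :
  eta [set: T] = 1%E -> (0 < #|J|)%N ->
  (forall j, measurable (S j)) -> (forall j, fine (eta (S j)) = c) ->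
  c ^+ 2 <= (\sum_(p : J * J) fine (eta (S p.1 `&` S p.2))) / #|{: J * J}|%:R.
Proof.
move=> eta1 J0 mS Sc.
have J1 : #|J|%:R != 0 :> R by rewrite pnatr_eq0 -lt0n.
pose X (x : T) : R := (\sum_j \1_(S j) x) / #|J|%:R.
pose Y (x : T) : R := (\sum_(p : J * J) \1_(S p.1 `&` S p.2) x) / #|{: J * J}|%:R.
have mSS (p : J * J) : measurable (S p.1 `&` S p.2) by exact: measurableI.
have [XU XI] := unit_mfun_mean _ _ _ eta _ _ (fun j => unit_mfun_indic _ (mS j)).
have [YU YI] := unit_mfun_mean _ _ _ eta _ _ (fun p => unit_mfun_indic _ (mSS p)).
have -> : (\sum_(p : J * J) fine (eta (S p.1 `&` S p.2))) / #|{: J * J}|%:R =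
    \int[eta]_x Y x.
  by rewrite YI; congr (_ / _); apply: eq_bigr => p _; rewrite Rintegral_indic.
have IX : \int[eta]_x X x = c.
  rewrite XI (eq_bigr (fun=> c)); last by move=> j _; rewrite Rintegral_indic.
  by rewrite sumr_const -[c *+ _]mulr_natr mulfK.
have XY x : Y x = X x ^+ 2.
  rewrite /Y /X card_prod natrM expr2 mulf_div; congr (_ / _).
  rewrite mulr_suml -(pair_bigA _ (fun i j => \1_(S i `&` S j) x)) /=.
  apply: eq_bigr => i _; rewrite mulr_sumr; apply: eq_bigr => j _.
  by rewrite indicI.
have iX := unit_mfun_integrable _ _ _ eta _ XU.
have iY := unit_mfun_integrable _ _ _ eta _ YU.
have i2X : eta.-integrable [set: T] (EFin \o (fun x => 2 * c * X x)).
  exact: (integrableZl measurableT (2 * c) iX).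
have ic : eta.-integrable [set: T] (EFin \o (fun x : T => c ^+ 2)).
  by apply: finite_measure_integrable_cst.
(* Since [eta] has mass 1 and [X] has mean [c], integrating [2 c X - c ^ 2 <= X ^ 2] suffices. *)
have -> : c ^+ 2 = \int[eta]_x (2 * c * X x - c ^+ 2).
  rewrite RintegralB // RintegralZl // Rintegral_cst // IX [fine _](congr1 fine eta1) /=; ring.
apply: le_Rintegral => //.
  exact: (integrableB _ i2X ic).
move=> x _; rewrite XY.
rewrite -subr_ge0 (_ : _ - _ = (X x - c) ^+ 2) ?sqr_ge0 //; ring.
Qed.

End PairCorrelations.

(** * Averages of characters over boxes *)

Section TrivialCharacter.
Variables (R : realType) (n : nat).
Local Notation M := 'M[int]_n.+2.
Local Notation I := 'I_n.+2.
Local Notation cval := (cval R n).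
Implicit Types (A B C : M) (chi : dual R n.+2).

(** Points are counted through their coefficient functions, with multiplicity, so that character
    sums over a box factor into geometric sums. *)
Definition box (N : nat) (f : {ffun I * I -> 'I_N.+1}) : M := \sum_p gen n p *+ f p.

Lemma trace0_box N f : trace0 (box N f).
Proof.
apply: (big_ind (@trace0 n.+2)); [exact: trace00|by move=> A B; exact: trace0D|].
by move=> p _; apply/trace0Mn/trace0_gen.
Qed.

Lemma cval_box N f chi : cval chi (box N f) = \prod_p cval chi (gen n p) ^+ f p.
Proof.
rewrite /box.
suff [] : trace0 (\sum_p gen n p *+ f p) /\
  cval chi (\sum_p gen n p *+ f p) = \prod_p cval chi (gen n p) ^+ f p by [].
elim/big_rec2: _ => [|p z A _ [A0 e]]; first by split; [exact: trace00|exact: cval0].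
have t : trace0 (gen n p *+ f p) by apply/trace0Mn/trace0_gen.
split; first exact: trace0D.
by rewrite cvalD // e cvalMn //; exact: trace0_gen.
Qed.

(** Expanding the square turns this into a mean over differences of box points; factoring the sum
    turns it into a product over generators. *)
Definition box_mean (N : nat) chi : R :=
  (normc (\sum_(f : {ffun I * I -> 'I_N.+1}) cval chi (box N f)) /
   #|{ffun I * I -> 'I_N.+1}|%:R) ^+ 2.

Lemma box_mean_pairs N chi : box_mean N chi =
  (\sum_(p : {ffun I * I -> 'I_N.+1} * {ffun I * I -> 'I_N.+1})
     complex.Re (cval chi (box N p.1 - box N p.2))) /
  #|{: {ffun I * I -> 'I_N.+1} * {ffun I * I -> 'I_N.+1}}|%:R.
Proof.
rewrite /box_mean expr_div_n card_prod natrM [_%:R ^+ 2]expr2; congr (_ / _).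
set s := \sum_f _.
have -> : normc s ^+ 2 = complex.Re (s * conjc s) by rewrite mulc_conj.
rewrite /s rmorph_sum mulr_suml.
rewrite (raddf_sum (@complex.Re R : Rcomplex R -> R)).
rewrite -(pair_bigA _ (fun f g => complex.Re (cval chi (box N f - box N g)))) /=.
apply: eq_bigr => f _; rewrite mulr_sumr (raddf_sum (@complex.Re R : Rcomplex R -> R)).
apply: eq_bigr => g _.
suff e : cval chi (box N f) * conjc (cval chi (box N g)) = cval chi (box N f - box N g).
  exact: (congr1 (@complex.Re R) e).
have tg := trace0_box N g.
suff -> : conjc (cval chi (box N g)) = (cval chi (box N g))^-1.
  by rewrite cvalB //; exact: trace0_box.
apply: (mulfI (cval_neq0 R n chi _ tg)); rewrite divff ?cval_neq0 //.
by rewrite normc1_conj // cval_norm.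
Qed.

Lemma box_mean_prod N chi : box_mean N chi =
  \prod_p (normc (\sum_(k < N.+1) cval chi (gen n p) ^+ k) / N.+1%:R) ^+ 2.
Proof.
rewrite prodrXl /box_mean; congr (_ ^+ _).
rewrite big_split /= prodfV; congr (_ / _); last first.
  by rewrite card_ffun card_ord natrX prodr_const.
under eq_bigr => f _ do rewrite cval_box.
rewrite -(bigA_distr_bigA (fun p (k : 'I_N.+1) => cval chi (gen n p) ^+ k)).
elim/big_rec2: _ => [|p x y _ <-]; first by rewrite normc1.
by rewrite normcM.
Qed.

Definition trivial_indicator chi : R := (`[< trivial_on_trace0 R n chi >])%:R.

(** A nontrivial character differs from 1 at some generator, whose factor is [O(1 / N)] by the
    geometric sum; the other factors lie between 0 and 1. *)
Lemma box_mean_cvg chi : box_mean ^~ chi @ \oo --> trivial_indicator chi.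
Proof.
rewrite /trivial_indicator.
have z1 p : normc (cval chi (gen n p)) = 1 by apply/cval_norm/trace0_gen.
have term01 N p : 0 <= normc (\sum_(k < N.+1) cval chi (gen n p) ^+ k) / N.+1%:R <= 1.
  rewrite divr_ge0 ?normc_ge0 //= ler_pdivrMr ?ltr0Sn // mul1r.
  apply: (le_trans (normc_sum _ _ _ _ _)).
  apply: (@le_trans _ _ (\sum_(k < N.+1) 1)); last by rewrite sumr_const card_ord.
  by apply: ler_sum => k _; rewrite normcX z1 expr1n.
case: asboolP => [triv|/(contra_not (trivial_on_gens R n chi))/existsNP[p zp]].
  rewrite (_ : box_mean ^~ chi = cst 1); first exact: cvg_cst.
  apply/funext => N; rewrite box_mean_prod big1 // => p _.
  rewrite (eq_bigr (fun=> 1)); last by move=> k _; rewrite triv ?expr1n //; exact: trace0_gen.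
  by rewrite sumr_const card_ord normc_nat divff ?expr1n // pnatr_eq0.
pose K : R := 1%:R *+ 2 / normc (cval chi (gen n p) - 1).
have sN N : normc (\sum_(k < N.+1) cval chi (gen n p) ^+ k) <= K.
  apply: (sum_le_of_shift R (fun k => cval chi (gen n p) ^+ k) 1 N.+1 (cval chi (gen n p))).
  - by move=> k; rewrite normcX z1 expr1n.
  - by move=> k; rewrite addn1 exprS.
  - exact/eqP.
apply: (squeeze_cvgr (f := cst 0) (h := fun N => K * harmonic N)).
- apply: nearW => N; rewrite box_mean_prod; apply/andP; split.
    by apply: prodr_ge0 => q _; exact: sqr_ge0.
  rewrite (bigD1 p) //=.
  have /andP[t0 t1] := term01 N p.
  apply: (@le_trans _ _ (normc (\sum_(k < N.+1) cval chi (gen n p) ^+ k) / N.+1%:R)).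
    rewrite -[leRHS]mulr1; apply: ler_pM.
    + exact: sqr_ge0.
    + by apply: prodr_ge0 => q _; exact: sqr_ge0.
    + by rewrite expr2 ler_piMr.
    + apply: prodr_ile1 => q _; have /andP[u0 u1] := term01 N q.
      by rewrite sqr_ge0 expr_le1.
  by rewrite /harmonic ler_wpM2r.
- exact: cvg_cst.
- rewrite -[X in _ --> X](mulr0 K); apply: cvgM; [exact: cvg_cst|exact: cvg_harmonic].
Qed.

(** * Correlations of the system and recurrence along a conjugacy class *)

Section System.
Variables (T : pseudoPMetricType R) (eta : probability (borel R T) R).
Variables (sigma : M -> borel R T -> borel R T) (Bt : set (borel R T)).
Variables (nu : {finite_measure set dual R n.+2 -> \bar R}).
Hypothesis sys : mps R n.+2 T eta sigma.
Hypothesis mBt : measurable Bt.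
Hypothesis spec : spectral_measure R n.+2 T eta sigma Bt nu.

Lemma measurable_preimage A (S : set (borel R T)) : trace0 A -> measurable S ->
  measurable (sigma A @^-1` S).
Proof.
move=> A0 mS; have [_ _ [_ _ ms _]] := sys.
by rewrite -[X in measurable X]setTI; apply: ms.
Qed.

Lemma Rintegral_cval A : trace0 A ->
  \int[nu]_chi complex.Re (cval chi A) = fine (eta (Bt `&` sigma A @^-1` Bt)).
Proof. by move=> A0; have [-> _] := spec A A0. Qed.

(** The left-hand set is the preimage of the right-hand one under [sigma B], which preserves
    [eta]. *)
Lemma correlation_shift A B : trace0 A -> trace0 B ->
  eta (sigma A @^-1` Bt `&` sigma B @^-1` Bt) = eta (Bt `&` sigma (A - B) @^-1` Bt).
Proof.
move=> A0 B0; have [_ _ [_ sD _ sI]] := sys.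
have AB0 := trace0B _ _ _ A0 B0.
rewrite -(sI B (Bt `&` sigma (A - B) @^-1` Bt)) //; last first.
  by apply: measurableI => //; exact: measurable_preimage.
congr (eta _); apply/seteqP; split => x /= [h1 h2]; split => //.
  by rewrite -sD // subrK.
by rewrite -[A](subrK B) sD.
Qed.

(** The integral of [box_mean N] is a mean of correlations over pairs of box points, bounded below
    by [pair_correlation_ge]; then [N] tends to infinity. *)
Lemma trivial_character_mass :
  unit_mfun _ _ R trivial_indicator /\
  fine (eta Bt) ^+ 2 <= \int[nu]_chi trivial_indicator chi.
Proof.
have tB N f g : trace0 (box N f - box N g) by apply: trace0B; exact: trace0_box.
have mean N := unit_mfun_mean _ _ _ nu _ _
  (fun p : {ffun I * I -> 'I_N.+1} * {ffun I * I -> 'I_N.+1} =>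
     unit_mfun_Re_cval R n _ (tB N p.1 p.2)).
have bE N : box_mean N = _ := funext (box_mean_pairs N).
apply: (unit_mfun_cvg_ge _ _ _ nu box_mean); last exact: box_mean_cvg.
  by move=> N; have [U _] := mean N; rewrite bE.
move=> N; have [_ e] := mean N; rewrite bE e.
have [_ _ [_ _ _ sI]] := sys.
have := pair_correlation_ge _ _ _ eta {ffun I * I -> 'I_N.+1}
  (fun f => sigma (box N f) @^-1` Bt) (fine (eta Bt)) (probability_setT eta).
rewrite card_ffun card_ord expn_gt0 => /(_ isT).
move=> /(_ (fun f => measurable_preimage _ _ (trace0_box N f) mBt)).
move=> /(_ (fun f => congr1 fine (sI _ _ (trace0_box N f) mBt))) h.
apply: (le_trans h); rewrite le_eqVlt; apply/orP; left; apply/eqP; congr (_ / _).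
apply: eq_bigr => p _; rewrite Rintegral_cval //.
exact: (congr1 fine (correlation_shift _ _ (trace0_box N p.1) (trace0_box N p.2))).
Qed.

Lemma recurrent_conjugate C : trace0 C -> C != 0 -> (0 < eta Bt)%E ->
  no_finite_order_atoms R n.+2 nu ->
  exists A, orbit n C A /\ (0 < eta (Bt `&` sigma A @^-1` Bt))%E.
Proof.
move=> C0 Cn0 Bt0 natoms; apply: contrapT => H.
have corr0 A : orbit n C A -> eta (Bt `&` sigma A @^-1` Bt) = 0%E.
  move=> OA; apply/eqP; rewrite eq_le measure_ge0 andbT leNgt.
  by apply/negP => h; apply: H; exists A.
have base : all_null R n nu C [::].
  split => // A OA; have A0 := orbit_trace0 _ _ _ OA C0.
  rewrite (_ : rational_part R n [::] A = fun chi => complex.Re (cval chi A)).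
    split; first exact: unit_mfun_Re_cval.
    by rewrite Rintegral_cval // corr0.
  by apply/funext => chi; rewrite /rational_part asboolT // => w; rewrite in_nil.
have [D [[oD /(_ C (orbit_refl n C))[fU f0]] hD]] := all_null_gens R n nu C C0 Cn0 base.
have [tU tI] := trivial_character_mass.
have c0 : 0 < fine (eta Bt).
  by rewrite fine_gt0 // Bt0 /= (le_lt_trans (probability_le1 eta mBt)) // ltry.
(* A character rational on [D] is a root of unity on all generators, as [D] reaches nonzero
   multiples of them; it thus has finite order, and outside the negligible set it is trivial. *)
have off chi : ~ nontrivial_finite_order R n.+2 chi ->
    rational_part R n D C chi = trivial_indicator chi.
  move=> nf; rewrite /rational_part /trivial_indicator.
  case: asboolP => [rD|nD]; case: asboolP => [tr|ntr] //.
  - by rewrite tr.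
  - exfalso; apply: nf; apply/nontrivial_finite_orderP; split => //.
    apply: finite_order_of_gens => p.
    have [->|[w [c [wD cn0 e]]]] := hD p.
      by rewrite cval0; exists 1%N; rewrite expr1n.
    apply: (root_of_unity_cvalMz R n _ _ c) => //; first exact: trace0_gen.
    by rewrite -e; exact: rD.
  - exfalso; apply: nD => w wD; rewrite tr.
      by exists 1%N; rewrite expr1n.
    by apply: trace0_act => //; exact: (allP oD).
have : \int[nu]_chi rational_part R n D C chi = \int[nu]_chi trivial_indicator chi.
  rewrite /Rintegral; congr fine; apply: ae_eq_integral => //.
  - by apply/measurable_EFinP; have [] := fU.
  - by apply/measurable_EFinP; have [] := tU.
  - apply: (negligibleS _ (finite_order_negligible R n nu natoms)) => chi /= h.
    by apply: contrapT => /off e; apply: h => _; rewrite e.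
rewrite f0 => e; move: tI; rewrite -e leNgt.
by rewrite exprn_gt0.
Qed.

End System.
End TrivialCharacter.

(** * From recurrence back to differences *)

Lemma ubd_gt0_nonempty (R : realType) (d : nat) (B : set 'M[int]_d) :
  (0 < ubd R d B)%E -> exists b, B b.
Proof.
move=> h; apply: contrapT => nB; move: h; apply/negP; rewrite -leNgt.
apply: ge_ereal_sup => _ [F _ <-].
have -> : dens_ratio R d B F = cst 0%E.
  apply/funext => k; rewrite /dens_ratio.
  have -> : [fset x in F k | `[< B x >]]%fset = fset0.
    apply/fsetP => x; rewrite !inE /=; apply/negbTE; rewrite negb_and.
    by apply/orP; right; apply/negP => /asboolP Bx; apply: nB; exists x.
  by rewrite cardfs0 mul0r.
have c0 : (cst 0%E : (\bar R)^nat) @ \oo --> (0%E : \bar R) by exact: cvg_cst.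
have l0 : limn (cst 0%E : (\bar R)^nat) = 0%E by exact: cvg_lim.
by rewrite is_cvg_limn_esupE ?l0 //; apply/cvg_ex; exists 0%E.
Qed.

Theorem theorem1p3 (R : realType) (d : nat) (B : set 'M[int]_d) :
  (2 <= d)%N ->
  (forall b, B b -> trace0 b) ->
  (0 < ubd R d B)%E ->
  good_furstenberg_system R d B ->
  forall C : 'M[int]_d, trace0 C ->
    exists (A g : 'M[int]_d),
      (exists b1 b2, B b1 /\ B b2 /\ A = b1 - b2) /\
      \det g = 1 /\ C = invmx g *m A *m g.
Proof.
case: d B => [//|[//|n]] B _ trB B0 [T [eta [sigma [Bt [nu [sys _ [mBt cBt eB] spec natoms]]]]]] C C0.
(* The zero matrix is the difference of any element of [B] with itself. *)
have [->|Cn0] := eqVneq C 0.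
  have [b Bb] := ubd_gt0_nonempty _ _ _ B0.
  exists 0, 1%:M; split; first by exists b, b; rewrite subrr.
  by rewrite det1 mulmx0 mul0mx.
have [|A [OA hA]] := recurrent_conjugate R n T eta sigma Bt nu sys mBt spec C C0 Cn0 _ natoms.
  by rewrite eB.
have A0 := orbit_trace0 _ _ _ OA C0.
have [g [dg Ag]] := OA.
have ug : g \in unitmx by rewrite unitmxE dg unitr1.
exists A, g; split; last first.
  by split => //; rewrite -mulmxA Ag mulKmx.
have NA0 := trace0N _ _ A0.
have [_ _ [s0 sD _ _]] := sys.
(* The density bound is stated with images and the spectral identity with preimages, hence the
   passage to [- A]. *)
have im : sigma (- A) @` Bt = sigma A @^-1` Bt.
  apply/seteqP; split => [_ [x Bx <-]|x /= Bx].
    by rewrite /= -sD // subrr s0.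
  by exists (sigma A x) => //; rewrite -sD // addNr s0.
(* Positive density makes the intersection of [B] with its translate by [- A] nonempty:
   [b = b' - A]. *)
have := cBt (- A) NA0; rewrite im => /(lt_le_trans hA) /ubd_gt0_nonempty [b [Bb [b' Bb' e]]].
by exists b', b; split => //; split => //; rewrite -e opprD opprK addrA subrr add0r.
Qed.
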